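(* Let $k$ be a field of characteristic $0$, let $\widetilde{W}$ be a finite reflection group on a graded finite-dimensional $k$-vector space $\widetilde{V}$, let $G$ be a normal subgroup of $\widetilde{W}$ and let $W=\widetilde{W}/G$. Let $V$ be the tangent space at $0$ to $\widetilde{V}/G$, let $A=k[V]$, and let $I\subset A$ be the ideal defining the closed subscheme $\widetilde{V}/G\hookrightarrow V$. Then $W$ is a reflection group on $V$ if and only if $G$ is of complete intersection and $W$ acts trivially on $I/A_+I$.
   Context: A grading on a finite-dimensional $k$-vector space is an algebraic action of $k^\times$ with strictly positive weights; $GL_{grad}(\widetilde V)$ is the group of elements of $GL(\widetilde V)$ commuting with this action. A reflection is an automorphism $g$ of finite order with $\ker(g-1)$ a hyperplane; a finite group of linear automorphisms is a reflection group if it is generated by its reflections. Here $\widetilde W\subset GL_{grad}(\widetilde V)$. For a vector space $V$, $k[V]$ is the symmetric algebra of $V^*$. Put $B=k[\widetilde V]$ (graded) and $\widetilde V/G=\operatorname{Spec} B^G$. Let $B^G_+$ be the ideal of $B^G$ spanned by homogeneous elements of positive degree, and let $V=(B^G_+/(B^G_+)^2)^*$, a graded vector space (the tangent space at $0$). Let $N(G)$ be the normalizer of $G$ in $GL_{grad}(\widetilde V)$. One fixes a graded $N(G)$-equivariant splitting $V^*\to B^G_+$ of the canonical surjection; it induces a surjection of graded algebras $A=k[V]\to B^G$ with kernel $I$, i.e. an $N(G)$-equivariant closed immersion $\widetilde V/G\hookrightarrow V$. The group $W$ acts linearly on $V$. $A_+$ is the ideal of $A$ spanned by homogeneous elements of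 positive degree. $G$ is of complete intersection if the minimal number of generators of $I$ is $\dim V-\dim\widetilde V$. *)

(* Defs.v *)
From HB Require Import structures.
From mathcomp Require Import all_boot all_order all_algebra.
From mathcomp Require Import all_fingroup all_character.
From mathcomp Require Export mpoly.

Set Implicit Arguments.
Unset Strict Implicit.
Unset Printing Implicit Defensive.

Import GRing.Theory.
Local Open Scope ring_scope.

(* A graded vector space is written in a basis of weight vectors: it is the   *)
(* space of column vectors 'cV[k]_n, on which t in k^x acts by the diagonal   *)
(* matrix with entries t ^+ d i, for a family d of positive weights.          *)
(* The algebra k[V] is {mpoly k[n]}: 'X_i is the i-th coordinate function and *)
(* has degree d i.                                                            *)

Definition grading_mx (k : fieldType) n (d : 'I_n -> nat) (t : k) : 'M[k]_n :=
  diag_mx (\row_i t ^+ d i).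

Definition GLgrad (k : fieldType) n (d : 'I_n -> nat) (M : 'M[k]_n) : Prop :=
  M \in unitmx /\
  forall t : k, t != 0 -> M *m grading_mx d t = grading_mx d t *m M.

Definition wdeg n (d : 'I_n -> nat) (m : 'X_{1..n}) : nat :=
  (\sum_i m i * d i)%N.

Lemma wdeg0 n (d : 'I_n -> nat) : wdeg d 0%MM = 0%N.
Proof. by rewrite /wdeg big1 // => i _; rewrite mnm0E mul0n. Qed.

Lemma wdegD n (d : 'I_n -> nat) (m1 m2 : 'X_{1..n}) :
  wdeg d (m1 + m2)%MM = (wdeg d m1 + wdeg d m2)%N.
Proof.
by rewrite /wdeg -big_split; apply: eq_bigr => i _; rewrite mnmDE mulnDl.
Qed.

HB.instance Definition _ n (d : 'I_n -> nat) :=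
  isMeasure.Build n (wdeg d) (wdeg0 d) (wdegD d).

(* Action on k[V] of an automorphism M of V: (M . p)(v) = p (M^-1 v).         *)
Definition mpoly_act (k : fieldType) n (M : 'M[k]_n) (p : {mpoly k[n]}) :
    {mpoly k[n]} :=
  p \mPo [tuple \sum_j (invmx M i j) *: 'X_j | i < n].

(* Meant for elements of finite groups of matrices, whose finite order is     *)
(* automatic. The transpose turns the kernel of M - 1 on                      *)
(* column vectors into a row space.                                           *)
Definition is_reflection (k : fieldType) n (M : 'M[k]_n) : bool :=
  ((\rank (kermx (M - 1%:M)^T)).+1 == n)%N.

Definition reflection_group (k : fieldType) (gT : finGroupType)
    (H : {group gT}) n (rho : mx_representation k H n) : Prop :=
  mx_faithful rho /\
  <<[set h in H | is_reflection (rho h)]>>%g = H.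

Section PolynomialIdeals.

Variables (k : fieldType) (n : nat).
Implicit Types (P Q : {mpoly k[n]} -> Prop) (p : {mpoly k[n]}).

(* Span of the homogeneous elements of positive degree of P.                  *)
Definition irrelevant (d : 'I_n -> nat) P p : Prop :=
  exists2 s : seq {mpoly k[n]},
    forall q, q \in s ->
      P q /\ exists2 m : nat, (0 < m)%N & q \is m.-homog for (wdeg d)
    & p = \sum_(q <- s) q.

(* Finite sums of products; the product of two ideals.                        *)
Definition ideal_mul P Q p : Prop :=
  exists2 s : seq ({mpoly k[n]} * {mpoly k[n]}),
    forall ab, ab \in s -> P ab.1 /\ Q ab.2
    & p = \sum_(ab <- s) ab.1 * ab.2.

Definition generates m (s : m.-tuple {mpoly k[n]}) P : Prop :=
  forall p, P p <->
    exists c : 'I_m -> {mpoly k[n]}, p = \sum_(i < m) c i * tnth s i.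

Definition min_generators P (m : nat) : Prop :=
  (exists s : m.-tuple {mpoly k[n]}, generates s P) /\
  forall (m' : nat) (s : m'.-tuple {mpoly k[n]}), generates s P -> (m <= m')%N.

End PolynomialIdeals.

Section Quotient.

Variables (k : fieldType) (gT : finGroupType) (n : nat).
Variables (d : 'I_n -> nat) (rho : gT -> 'M[k]_n) (G : {set gT}).

Definition invariant (p : {mpoly k[n]}) : Prop :=
  forall g, g \in G -> mpoly_act (rho g) p = p.

Definition invariant_plus : {mpoly k[n]} -> Prop := irrelevant d invariant.

Definition invariant_plus2 : {mpoly k[n]} -> Prop :=
  ideal_mul invariant_plus invariant_plus.

Definition normalizer_GLgrad (P : 'M[k]_n) : Prop :=
  GLgrad d P /\
  forall M : 'M[k]_n,
    (exists2 g, g \in G & M = rho g) <->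
    (exists2 g, g \in G & P *m M *m invmx P = rho g).

Variables (r : nat) (e : 'I_r -> nat) (f : r.-tuple {mpoly k[n]}).

(* The classes of the f_i form a basis of V^* = B^G_+ / (B^G_+)^2.            *)
Definition cotangent_basis : Prop :=
  [/\ forall i, invariant_plus (tnth f i),
      forall p, invariant_plus p ->
        exists a : 'I_r -> k,
          invariant_plus2 (p - \sum_i a i *: tnth f i)
    & forall a : 'I_r -> k,
        invariant_plus2 (\sum_i a i *: tnth f i) -> forall i, a i = 0].

(* A graded N(G)-equivariant splitting V^* -> B^G_+, given by its values f_i  *)
(* on a basis (x_i) of V^* with x_i homogeneous of degree e i. Being a        *)
(* splitting means that x_i is the class of f_i.                              *)
Definition equivariant_splitting : Prop :=
  [/\ cotangent_basis,
      forall i, (0 < e i)%N /\ tnth f i \is (e i).-homog for (wdeg d)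
    & forall P : 'M[k]_n, normalizer_GLgrad P ->
      forall T : 'M[k]_r,
        (forall i, invariant_plus2
                     (mpoly_act P (tnth f i) - \sum_j T i j *: tnth f j)) ->
        forall i, mpoly_act P (tnth f i) = \sum_j T i j *: tnth f j].

(* The kernel I of the morphism A = k[V] -> B^G sending 'X_i to f_i.          *)
Definition quotient_ideal (p : {mpoly k[r]}) : Prop := p \mPo f = 0.

Definition complete_intersection : Prop :=
  exists2 m : nat, min_generators quotient_ideal m & (n + m = r)%N.

(* A_+ I, for the grading of A in which 'X_i has degree e i.                  *)
Definition irrelevant_mul_ideal : {mpoly k[r]} -> Prop :=
  ideal_mul (irrelevant e (fun _ => True)) quotient_ideal.

End Quotient.

(* rV is the action of W = Wt / G on the tangent space V, in the basis of V   *)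
(* dual to the classes x_i of the f_i: for w in Wt, the class of w . f_i is   *)
(* w . x_i, whose coordinates are the i-th row of rV (w)^-1.                  *)
Definition tangent_action (k : fieldType) (gT : finGroupType)
    (Wt G : {group gT}) n r (d : 'I_n -> nat)
    (rW : mx_representation k Wt n) (f : r.-tuple {mpoly k[n]})
    (rV : mx_representation k (Wt / G)%g r) : Prop :=
  forall w, w \in Wt -> forall i,
    invariant_plus2 d rW G
      (mpoly_act (rW w) (tnth f i)
       - \sum_j (invmx (rV (coset G w)) i j) *: tnth f j).

(* Main.v *)
Require Import Defs.
From HB Require Import structures.
From mathcomp Require Import all_boot all_order all_algebra.
From mathcomp Require Import all_fingroup all_character.
From mathcomp Require Import ring.
From Stdlib Require Import Classical.

Set Implicit Arguments.
Unset Strict Implicit.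
Unset Printing Implicit Defensive.

Import GRing.Theory.
Local Open Scope ring_scope.

(* Let A = k[V], B = k[Vt] and W = Wt / G, so that B^G = A / I and, by         *)
(* Chevalley, B^Wt is a polynomial algebra on n generators psi_i. Averaging    *)
(* over W, A^W maps onto (B^G)^W = B^Wt; lift the psi_i to elements of A^W.    *)
(*                                                                            *)
(* If W is a reflection group, A^W is a polynomial algebra on r generators,    *)
(* which may be chosen to be the lifts of the psi_i and r - n elements a_j of  *)
(* I^W. As A is generated by |W| elements as an A^W-module while B^G has rank  *)
(* |W| over B^Wt, a relation between the images of these generators in B^G     *)
(* with coefficients in B^Wt is trivial; hence I = A I^W = (a_j). The a_j are  *)
(* W-invariant and independent modulo A_+ I.                                   *)
(*                                                                            *)
(* Conversely, if I / A_+ I has dimension r - n and a trivial action of W, then*)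
(* I is generated by r - n invariants a_j, and the a_j and the lifts of the    *)
(* psi_i generate the algebra A^W; this forces W to be a reflection group by   *)
(* Serre's theorem.                                                            *)
(*                                                                            *)
(* Serre's theorem is obtained from Jacobians: if H is the subgroup generated  *)
(* by the reflections of W, A^H = k[theta] and A^W = k[phi], then the Jacobian *)
(* of phi with respect to theta divides products of linear forms v c - h c,    *)
(* with v in W but not in H and h in H. As v - h has rank at least 2, two such *)
(* products, for two generic linear forms c, are coprime, so the Jacobian is   *)
(* constant and phi generates A^H; thus A^H = A^W and H = W.                   *)

(** * Linear algebra, ideals and weighted homogeneous polynomials *)

(** The bridge between the two sides is a comparison of I^W modulo (A^W_+)^2 with I modulo A_+ I. A
    family a_j in I^W that spans I^W modulo (A^W_+)^2, joined to the lifts of the psi_i, generates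
    the algebra A^W ([adapted_generators]). Every element of I^W then lies in the ideal (a_j),
    because the psi_i are algebraically independent ([adapted_ideal]).

    The rest is a count. For a reflection group, invariants independent modulo (A^W_+)^2 are at most
    as many as the dimension ([free_invariants_le]): Chevalley's argument [free_over_invariants] is
    applied to their gradients, and Euler's formula returns from gradients to invariants. For any
    faithful representation, generators of the invariants are at least as many as the dimension
    ([generators_ge]).

    If W is a reflection group, both bounds give the number r - n of the a_j, and [module_syzygies]
    passes from I^W to I. Conversely, a trivial action on I / A_+ I allows generators of I to be
    chosen in I^W by averaging; A^W then has at most r generators, and [serre_reflection_group]
    concludes. *)

Lemma wide_kernel (R : idomainType) m n (M : 'M[R]_(m, n)) :
  (n < m)%N -> exists2 v : 'rV[R]_m, v != 0 & v *m M = 0.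
Proof.
move=> lt_nm.
(* Padding with zero columns gives a square matrix of determinant 0, whose kernel vector has entries
   in [R] itself. *)
pose M' : 'M[R]_m := \matrix_(i, j) oapp (M i) 0 (insub (j : nat)).
have /det0P[v nz_v vM'] : \det M' == 0.
  rewrite -det_tr; apply/det0P; exists (delta_mx 0 (Ordinal lt_nm)).
    apply/eqP=> /matrixP/(_ 0 (Ordinal lt_nm)); rewrite !mxE !eqxx /= => /eqP.
    by rewrite oner_eq0.
  by rewrite -rowE; apply/rowP=> i; rewrite !mxE insubN //= ltnn.
exists v => //; apply/rowP=> j.
have := congr1 (fun A : 'rV_m => A 0 (widen_ord (ltnW lt_nm) j)) vM'.
rewrite !mxE => v0; rewrite -[RHS]v0; apply: eq_bigr => i _; rewrite mxE.
case: insubP => [u _ eq_u | ]; last by rewrite /= (ltn_ord j).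
by congr (_ * M i _); apply: val_inj; rewrite eq_u.
Qed.

(** Dedekind's independence of characters, by induction on the number of nonzero coefficients. If x0
    separates i0 from j, the relation at x0 * x minus [s j x0] times the relation at x has no term
    in j, and its coefficient at i0 is a nonzero multiple of [c i0]. *)
Lemma dedekind_independence (I : finType) (P : {pred I}) (R : nzRingType)
    (S : idomainType) (s : I -> R -> S) (c : I -> S) :
    (forall i, {morph s i : x y / x * y}) -> (forall i, s i 1 = 1) ->
    {in P &, forall i j, i != j -> exists x, s i x != s j x} ->
  (forall x, \sum_(i in P) c i * s i x = 0) -> {in P, forall i, c i = 0}.
Proof.
move=> sM s1 sI; move: {2}#|_|.+1 (ltnSn #|[set i in P | c i != 0]|) => N.
elim: N c => // N IHN c; rewrite ltnS => leN c0 i0 Pi0.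
apply/eqP; apply: contraT => nz_i0.
have [/existsP[j /and3P[Pj ne_j nz_j]]|] :=
  boolP [exists j, [&& j \in P, j != i0 & c j != 0]].
  have [x0 ne_x0] := sI j i0 Pj Pi0 ne_j.
  suff /eqP : c i0 * (s i0 x0 - s j x0) = 0.
    by rewrite mulf_eq0 (negPf nz_i0) subr_eq0 eq_sym (negPf ne_x0).
  apply: (IHN (fun i => c i * (s i x0 - s j x0))) Pi0 => [|x].
    apply: leq_trans leN; apply: proper_card; apply/properP; split.
      apply/subsetP=> i; rewrite !inE mulf_eq0 negb_or.
      by case/and3P=> -> ->.
    by exists j; rewrite !inE ?nz_j ?Pj // subrr mulr0 eqxx.
  have /(congr1 (fun y => s j x0 * y)) := c0 x; rewrite mulr0 => jx0.
  transitivity (\sum_(i in P) c i * s i (x0 * x)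
                - s j x0 * \sum_(i in P) c i * s i x).
    rewrite mulr_sumr -sumrB.
    by apply: eq_bigr => i _; rewrite sM mulrBr mulrBl !mulrA (mulrC (s j x0)).
  by rewrite c0 jx0 subr0.
rewrite negb_exists => /forallP cz; have := c0 1.
rewrite (bigD1 i0) //= s1 mulr1 big1 ?addr0 => [/eqP|i /andP[Pi ne_i]].
  by rewrite (negPf nz_i0).
by have := cz i; rewrite Pi ne_i /= negbK => /eqP->; rewrite mul0r.
Qed.

Definition subspace (k : fieldType) (V : lmodType k) (U : V -> Prop) : Prop :=
  [/\ U 0, forall x y, U x -> U y -> U (x + y) & forall a x, U x -> U (a *: x)].

(** Independence, and below spanning, in the quotient V / U, expressed without forming the quotient.
    The subspace U will be (A^W_+)^2, A_+ I or the Hilbert ideal. *)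
Definition free_mod (k : fieldType) (V : lmodType k) (U : V -> Prop) m
    (v : 'I_m -> V) : Prop :=
  forall a : 'I_m -> k, U (\sum_i a i *: v i) -> forall i, a i = 0.

Definition in_span_mod (k : fieldType) (V : lmodType k) (U : V -> Prop) m
    (v : 'I_m -> V) (q : V) : Prop :=
  exists a : 'I_m -> k, U (q - \sum_i a i *: v i).

Section Subspaces.

Variables (k : fieldType) (V : lmodType k) (U : V -> Prop).
Hypothesis subU : subspace U.

Lemma subspace_opp x : U x -> U (- x).
Proof. by case: subU => _ _ UZ /(UZ (-1)); rewrite scaleN1r. Qed.

Lemma subspace_sub x y : U x -> U y -> U (x - y).
Proof. by case: subU => _ UD _ Ux /subspace_opp; apply: UD. Qed.

Lemma subspace_sum I (s : seq I) (P : pred I) F :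
  (forall i, P i -> U (F i)) -> U (\sum_(i <- s | P i) F i).
Proof. by case: subU => U0 UD _; apply: big_ind. Qed.

Lemma subspace_in_span_mod m (v : 'I_m -> V) : subspace (in_span_mod U v).
Proof.
case: (subU) => U0 UD UZ; split.
- by exists (fun=> 0); rewrite big1 ?subr0 // => i _; rewrite scale0r.
- move=> x y [a Ua] [b Ub]; exists (fun i => a i + b i).
  have -> : \sum_i (a i + b i) *: v i = \sum_i a i *: v i + \sum_i b i *: v i.
    by rewrite -big_split; apply: eq_bigr => i _; rewrite scalerDl.
  by rewrite opprD addrACA; apply: UD.
move=> c x [a Ua]; exists (fun i => c * a i).
have -> : \sum_i (c * a i) *: v i = c *: \sum_i a i *: v i.
  by rewrite scaler_sumr; apply: eq_bigr => i _; rewrite scalerA.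
by rewrite -scalerBr; apply: UZ.
Qed.

Lemma in_span_mod_base m (v : 'I_m -> V) x : U x -> in_span_mod U v x.
Proof. by exists (fun=> 0); rewrite big1 ?subr0 // => i _; rewrite scale0r. Qed.


Lemma free_mod_le m (v : 'I_m -> V) l (w : 'I_l -> V) :
  free_mod U v -> (forall i, in_span_mod U w (v i)) -> (m <= l)%N.
Proof.
move=> freev /fin_all_exists[a aP]; rewrite leqNgt; apply/negP=> lt_lm.
have [c nz_c ca0] := wide_kernel (\matrix_(i, j) a i j) lt_lm.
case/eqP: nz_c; apply/rowP=> i; rewrite mxE; apply: freev i.
have -> : \sum_i c 0 i *: v i = \sum_i c 0 i *: (v i - \sum_j a i j *: w j).
  rewrite [RHS](eq_bigr (fun i => c 0 i *: v i - \sum_j (c 0 i * a i j) *: w j)).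
    rewrite sumrB [X in _ - X]exchange_big /= [X in _ - X]big1 ?subr0 // => j _.
    rewrite -scaler_suml; have /rowP/(_ j) := ca0; rewrite !mxE => /eqP ca0j.
    rewrite (eq_bigr (fun i => c 0 i * (\matrix_(i, j) a i j) i j)) => [|i _].
      by rewrite (eqP ca0j) scale0r.
    by rewrite mxE.
  move=> i _; rewrite scalerBr scaler_sumr; congr (_ - _).
  by apply: eq_bigr => j _; rewrite scalerA.
case: (subU) => _ _ UZ; apply: subspace_sum => i _; exact: UZ.
Qed.

Lemma free_mod_extend m (v : 'I_m -> V) q :
    free_mod U v -> ~ in_span_mod U v q ->
  free_mod U (fun i => oapp v q (unlift ord0 i)).
Proof.
case: (subU) => U0 UD UZ freev nsp a.
rewrite big_ord_recl unlift_none /=.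
rewrite (eq_bigr (fun i => a (lift ord0 i) *: v i)) => [Ua|i _]; last first.
  by rewrite liftK.
have [a0 | nz_a0] := eqVneq (a ord0) 0.
  move=> i; case: (unliftP ord0 i) => [j ->|-> //].
  by apply: (freev (fun j => a (lift ord0 j))); rewrite a0 scale0r add0r in Ua.
case: nsp; exists (fun i => - (a ord0)^-1 * a (lift ord0 i)).
have := UZ (a ord0)^-1 _ Ua; rewrite scalerDr scalerA mulVf // scale1r.
rewrite scaler_sumr -sumrN; congr (U (_ + _)); apply: eq_bigr => i _.
by rewrite mulNr scaleNr opprK scalerA.
Qed.

(** A family is extended as long as some element of [Q] escapes its span; the bound stops the
    process. [Q] is an arbitrary predicate, so that the family can be chosen homogeneous or made of
    monomials. *)
Lemma maximal_free_mod (Q : V -> Prop) N :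
    (forall m (v : 'I_m -> V), (forall i, Q (v i)) -> free_mod U v -> (m <= N)%N) ->
  exists m (v : 'I_m -> V),
    [/\ (m <= N)%N, forall i, Q (v i), free_mod U v
      & forall q, Q q -> in_span_mod U v q].
Proof.
move=> bound.
suff extend j m (v : 'I_m -> V) : (N - m <= j)%N ->
    (forall i, Q (v i)) -> free_mod U v ->
    exists m' (v' : 'I_m' -> V), [/\ (m' <= N)%N, forall i, Q (v' i), free_mod U v'
      & forall q, Q q -> in_span_mod U v' q].
  by apply: (extend N 0%N (fun=> 0)); [rewrite subn0 | case | move=> a _ []].
have ext m1 (v1 : 'I_m1 -> V) : (forall i, Q (v1 i)) -> free_mod U v1 ->
    (forall q, Q q -> in_span_mod U v1 q) \/
    (exists v' : 'I_m1.+1 -> V, (forall i, Q (v' i)) /\ free_mod U v').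
  move=> Qv freev; have [|nall] := classic (forall q, Q q -> in_span_mod U v1 q).
    by left.
  have [q nq] := not_all_ex_not _ _ nall; have [Qq nsp] := imply_to_and _ _ nq.
  right.
  exists (fun i => oapp v1 q (unlift ord0 i)); split; last exact: free_mod_extend.
  by move=> i; case: unliftP => /=.
elim: j m v => [|j IHj] m v le_j Qv freev;
  have [span|[v' [Qv' freev']]] := ext m v Qv freev.
- by exists m, v; split=> //; apply: bound freev.
- by have := bound _ _ Qv' freev'; rewrite ltnNge -subn_eq0 -leqn0 le_j.
- by exists m, v; split=> //; apply: bound freev.
by apply: (IHj _ v') => //; rewrite subnS -ltnS; case: (N - m)%N le_j.
Qed.

End Subspaces.

Section IdealMul.

Variables (k : fieldType) (n : nat).
Implicit Types (P Q X : {mpoly k[n]} -> Prop) (p q : {mpoly k[n]}).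

Lemma ideal_mul0 P Q : ideal_mul P Q 0.
Proof. by exists [::]; rewrite ?big_nil. Qed.

Lemma ideal_mulD P Q p q : ideal_mul P Q p -> ideal_mul P Q q -> ideal_mul P Q (p + q).
Proof.
move=> [s1 s1P ->] [s2 s2P ->]; exists (s1 ++ s2); last by rewrite big_cat.
by move=> x; rewrite mem_cat => /orP[/s1P|/s2P].
Qed.

Lemma ideal_mul_prod P Q a b : P a -> Q b -> ideal_mul P Q (a * b).
Proof.
by exists [:: (a, b)]; rewrite ?big_seq1 // => x; rewrite inE => /eqP->.
Qed.

Lemma ideal_mul_elim P Q X : X 0 -> (forall p q, X p -> X q -> X (p + q)) ->
    (forall a b, P a -> Q b -> X (a * b)) ->
  forall p, ideal_mul P Q p -> X p.
Proof.
move=> X0 XD XM p [s sP ->]; rewrite big_seq.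
by apply: big_ind => // ab /sP[]; apply: XM.
Qed.

Lemma ideal_mulM P Q c p :
  (forall a, P a -> P (c * a)) -> ideal_mul P Q p -> ideal_mul P Q (c * p).
Proof.
move=> Pc; move: p; apply: ideal_mul_elim => [|p q|a b Pa Qb].
- by rewrite mulr0; apply: ideal_mul0.
- by rewrite mulrDr; apply: ideal_mulD.
by rewrite mulrA; apply: ideal_mul_prod => //; apply: Pc.
Qed.

Lemma ideal_mul_mono P Q P' Q' p :
    (forall a, P a -> P' a) -> (forall a, Q a -> Q' a) ->
  ideal_mul P Q p -> ideal_mul P' Q' p.
Proof.
move=> PP QQ; move: p; apply: ideal_mul_elim; first exact: ideal_mul0.
  exact: ideal_mulD.
by move=> a b Pa Qb; apply: ideal_mul_prod; [apply: PP | apply: QQ].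
Qed.

Lemma subspace_ideal_mul P Q : subspace P -> subspace (ideal_mul P Q).
Proof.
case=> P0 PD PZ; split; first exact: ideal_mul0; first by move=> x y; apply: ideal_mulD.
move=> a x; rewrite -mul_mpolyC; apply: ideal_mulM => b.
by rewrite mul_mpolyC; apply: PZ.
Qed.

End IdealMul.

Section Mpoly.

Variable k : fieldType.

Lemma mpoly_subring_ind n (P : {mpoly k[n]} -> Prop) :
    (forall c, P c%:MP) -> (forall i, P 'X_i) ->
    (forall p q, P p -> P q -> P (p + q)) -> (forall p q, P p -> P q -> P (p * q)) ->
  forall p, P p.
Proof.
move=> PC PX PD PM p; rewrite (mpolyE p).
apply: big_ind => [||m _]; [by rewrite -mpolyC0 | exact: PD |].
rewrite -mul_mpolyC mpolyXE_id; apply: (PM) => //.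
apply: big_ind => [||i _]; [by rewrite -mpolyC1 | exact: (PM) |].
by elim: (m i) => [|j IHj]; [rewrite expr0 -mpolyC1 | rewrite exprS; apply: (PM)].
Qed.

Lemma comp_mpolyX1 n m (f : n.-tuple {mpoly k[m]}) i : 'X_i \mPo f = tnth f i.
Proof. by rewrite comp_mpolyXU -tnth_nth. Qed.

Lemma comp_mpolyM n m (f : n.-tuple {mpoly k[m]}) p q :
  (p * q) \mPo f = (p \mPo f) * (q \mPo f).
Proof. exact: rmorphM. Qed.

Lemma comp_mpolyA n m l (p : {mpoly k[n]}) (f : n.-tuple {mpoly k[m]})
    (g : m.-tuple {mpoly k[l]}) :
  (p \mPo f) \mPo g = p \mPo [tuple tnth f i \mPo g | i < n].
Proof.
elim/(@mpoly_subring_ind n): p => [c|i|p q IHp IHq|p q IHp IHq].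
- by rewrite !comp_mpolyC.
- by rewrite !comp_mpolyX1 tnth_mktuple.
- by rewrite !comp_mpolyD IHp IHq.
by rewrite !comp_mpolyM IHp IHq.
Qed.

Lemma mderiv_var n (i j : 'I_n) : ('X_i : {mpoly k[n]})^`M(j) = (i == j)%:R.
Proof.
rewrite mderivX mnm1E; case: eqP => [->|_]; last by rewrite scale0r.
by rewrite scale1r -{1}[U_(j)%MM]add0m addmK mpolyX0.
Qed.

Lemma mderiv_comp n m (p : {mpoly k[n]}) (f : n.-tuple {mpoly k[m]}) i :
  (p \mPo f)^`M(i) = \sum_j (p^`M(j) \mPo f) * (tnth f j)^`M(i).
Proof.
elim/mpoly_subring_ind: p => [c|l|p q IHp IHq|p q IHp IHq].
- by rewrite comp_mpolyC mderivC big1 // => j _; rewrite mderivC comp_mpoly0 mul0r.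
- rewrite comp_mpolyX1 (bigD1 l) //= big1 ?addr0 => [|j ne_jl].
    by rewrite mderiv_var eqxx rmorph1 mul1r.
  by rewrite mderiv_var eq_sym (negPf ne_jl) comp_mpoly0 mul0r.
- rewrite comp_mpolyD mderivD IHp IHq -big_split; apply: eq_bigr => j _.
  by rewrite mderivD comp_mpolyD mulrDl.
rewrite comp_mpolyM mderivM IHp IHq mulr_suml mulr_sumr -big_split.
apply: eq_bigr => j _; rewrite mderivM comp_mpolyD !comp_mpolyM mulrDl /=.
by rewrite mulrAC mulrA.
Qed.

Lemma mcoeff0M n (p q : {mpoly k[n]}) : (p * q)@_0 = p@_0 * q@_0.
Proof. exact: rmorphM. Qed.

Lemma mcoeff0_comp n m (p : {mpoly k[n]}) (f : n.-tuple {mpoly k[m]}) :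
  (forall i, (tnth f i)@_0 = 0) -> (p \mPo f)@_0 = p@_0.
Proof.
move=> f0; elim/(@mpoly_subring_ind n): p => [c|i|p q IHp IHq|p q IHp IHq].
- by rewrite comp_mpolyC !mcoeffC !eqxx.
- by rewrite comp_mpolyX1 f0 mcoeffX mnm1_eq0.
- by rewrite comp_mpolyD !mcoeffD IHp IHq.
by rewrite comp_mpolyM !mcoeff0M IHp IHq.
Qed.

End Mpoly.

Section WeightedHomogeneous.

Variables (k : fieldType) (n : nat) (d : 'I_n -> nat).
Implicit Types p q : {mpoly k[n]}.

Local Notation hc := (@pihomog n k (wdeg d)).

Lemma wdeg_eq0 (m : 'X_{1..n}) : (forall i, 0 < d i)%N -> (wdeg d m == 0%N) = (m == 0%MM).
Proof.
move=> d_gt0; apply/eqP/eqP => [|->]; last exact: wdeg0.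
move/eqP; rewrite sum_nat_eq0 => /forallP m0; apply/mnmP=> i.
by have := m0 i; rewrite mnm0E muln_eq0 (gtn_eqF (d_gt0 i)) orbF => /eqP.
Qed.

Lemma wdeg1 i : wdeg d U_(i) = d i.
Proof.
rewrite /wdeg (bigD1 i) //= mnm1E eqxx mul1n big1 ?addn0 // => j ne_ji.
by rewrite mnm1E eq_sym (negPf ne_ji).
Qed.

Lemma homog_X i : ('X_i : {mpoly k[n]}) \is (d i).-homog for (wdeg d).
Proof. by rewrite dhomogX; apply/eqP/wdeg1. Qed.

Lemma homog_components p : exists N, forall M, (N <= M)%N -> p = \sum_(i < M) hc i p.
Proof. by exists (mmeasure (wdeg d) p) => M le_M; apply: pihomog_partitionE. Qed.

Lemma pihomog_homog i j p : p \is j.-homog for (wdeg d) -> hc i p = if i == j then p else 0.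
Proof.
move=> hp; case: eqP => [->|/eqP ne_ij]; first exact: pihomog_dE.
by apply: pihomog_ne0 hp; rewrite eq_sym.
Qed.

Lemma pihomogM N p q : hc N (p * q) = \sum_(i < N.+1) hc i p * hc (N - i) q.
Proof.
have [[K1 K1P] [K2 K2P]] := (homog_components p, homog_components q).
pose K := maxn N.+1 (maxn K1 K2).
have [leN le1 le2] : [/\ N.+1 <= K, K1 <= K & K2 <= K]%N.
  by rewrite !leq_max !leqnn !orbT.
rewrite {1}(K1P _ le1) {1}(K2P _ le2) mulr_suml linear_sum /=.
rewrite (big_ord_widen_cond _ xpredT (fun i => hc i p * hc (N - i) q) leN).
rewrite [RHS]big_mkcond; apply: eq_bigr => i _ /=.
rewrite mulr_sumr linear_sum /= ltnS; case: leqP => [le_iN|lt_Ni].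
  have ltK : (N - i < K)%N by apply: leq_trans leN; rewrite ltnS leq_subr.
  rewrite (bigD1 (Ordinal ltK)) //= big1 => [|j ne_j].
    by rewrite addr0 pihomog_dE // -[X in X.-homog for _](subnKC le_iN) dhomogM // pihomogP.
  have hij := dhomogM (pihomogP (wdeg d) i p) (pihomogP (wdeg d) j q).
  rewrite (pihomog_ne0 _ hij) //; apply: contraNneq ne_j => eqN.
  by apply/eqP/val_inj; rewrite /= -eqN addKn.
rewrite big1 // => j _; have hij := dhomogM (pihomogP (wdeg d) i p) (pihomogP (wdeg d) j q).
by rewrite (pihomog_ne0 _ hij) // gtn_eqF // ltn_addr.
Qed.

Lemma pihomog0_mcoeff p : (forall i, 0 < d i)%N -> hc 0 p = (p@_0)%:MP.
Proof.
move=> d_gt0; apply/mpolyP=> m; rewrite mcoeffC.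
have [-> | nz_m] := eqVneq m 0%MM; last first.
  rewrite mulr0; apply: (dhomog_nemf_coeff (pihomogP (wdeg d) 0 p)).
  by rewrite wdeg_eq0.
rewrite mulr1; have [N NP] := homog_components p.
have := congr1 (mcoeff 0%MM) (NP N.+1 (leqnSn N)).
rewrite raddf_sum big_ord_recl => ->; rewrite [X in _ + X]big1 ?addr0 // => i _.
by apply: (dhomog_nemf_coeff (pihomogP (wdeg d) _ p)); rewrite mf0.
Qed.

Lemma homog_mcoeff0 p i : (0 < i)%N -> p \is i.-homog for (wdeg d) -> p@_0 = 0.
Proof.
by move=> i_gt0 hp; apply: (dhomog_nemf_coeff hp); rewrite mf0 eq_sym -lt0n.
Qed.

(** As the weights are positive, the component of degree 0 is the constant term. Graded ideals thus
    become conditions at the origin, which inhomogeneous elements can also satisfy. *)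
Lemma irrelevantP (P : {mpoly k[n]} -> Prop) p : (forall i, 0 < d i)%N -> subspace P ->
    (forall q i, P q -> P (hc i q)) ->
  irrelevant d P p <-> P p /\ p@_0 = 0.
Proof.
move=> d_gt0 subP Phc; split=> [[s sP ->]|[Pp p0]].
  rewrite big_seq; split; first by apply: subspace_sum => // q /sP[].
  rewrite raddf_sum big1 // => q /sP[_ [i i_gt0 hq]].
  exact: homog_mcoeff0 i_gt0 hq.
have [N NP] := homog_components p.
exists [seq hc i p | i <- iota 1 N].
  move=> q /mapP[i]; rewrite mem_iota => /andP[i_gt0 _] ->; split; first exact: Phc.
  by exists i => //; apply: pihomogP.
rewrite big_map {1}(NP N.+1) // -(big_mkord xpredT (fun i => hc i p)).
by rewrite big_ltn // pihomog0_mcoeff // p0 mpolyC0 add0r /index_iota subn1.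
Qed.

Lemma euler_mpoly i p : p \is i.-homog for (wdeg d) ->
  \sum_j (d j)%:R *: ('X_j * p^`M(j)) = i%:R *: p.
Proof.
move=> hp; rewrite [in RHS](mpolyE p) scaler_sumr.
transitivity (\sum_j \sum_(m <- msupp p) (d j)%:R *: ('X_j * (p@_m *: 'X_[m])^`M(j))).
  by apply: eq_bigr => j _; rewrite {1}(mpolyE p) linear_sum mulr_sumr scaler_sumr.
rewrite exchange_big /=; apply: eq_big_seq => m mp.
have /(_ m mp) <- := dhomog_mf hp.
rewrite /wdeg natr_sum scaler_suml; apply: eq_bigr => j _.
rewrite mderivZ mderivX -!scalerAr !scalerA mulrCA -natrM mulnC mulrC.
have [mj0 | mj_gt0] := posnP (m j); first by rewrite mj0 !mul0r !scale0r.
rewrite -mpolyXD addmC submK //; apply/mnm_lepP=> l; rewrite mnm1E.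
by case: eqP => [<-|].
Qed.

End WeightedHomogeneous.

Lemma comp_mpoly_homog (k : fieldType) n m (mf : measure n) (mg : measure m)
    (f : n.-tuple {mpoly k[m]}) (p : {mpoly k[n]}) e :
    (forall i, tnth f i \is (mf U_(i)%MM).-homog for mg) ->
  p \is e.-homog for mf -> p \mPo f \is e.-homog for mg.
Proof.
move=> hf /dhomogP hp; rewrite [p]mpolyE linear_sum big_seq.
apply: rpred_sum => l /hp <-; rewrite linearZ rpredZ //=.
rewrite mpolyXE_id rmorph_prod mfE /=.
apply: (big_ind2 (fun (q : {mpoly k[m]}) i => q \is i.-homog for mg)).
- exact: dhomog1.
- by move=> q1 a1 q2 a2; apply: dhomogM.
by move=> i _; rewrite rmorphXn mulnC dhomogMn //= comp_mpolyX1.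
Qed.

Lemma pihomog_comp (k : fieldType) n m (d : 'I_n -> nat) (d' : 'I_m -> nat)
    (f : n.-tuple {mpoly k[m]}) (p : {mpoly k[n]}) i :
    (forall j, tnth f j \is (d j).-homog for (wdeg d')) ->
  pihomog (wdeg d') i (p \mPo f) = pihomog (wdeg d) i p \mPo f.
Proof.
move=> hf; have [N NP] := homog_components d p.
have hM j : pihomog (wdeg d) j p \mPo f \is j.-homog for (wdeg d').
  by apply: comp_mpoly_homog (pihomogP _ _ _) => j'; rewrite /= wdeg1.
have -> : p \mPo f = \sum_(j < maxn N i.+1) (pihomog (wdeg d) j p \mPo f).
  by rewrite -linear_sum -NP // leq_maxl.
rewrite [LHS](linear_sum (pihomog (wdeg d') i)) /=.
have lt_i : (i < maxn N i.+1)%N by rewrite leq_max leqnn orbT.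
rewrite (bigD1 (Ordinal lt_i)) //= big1 => [|j ne_j].
  by rewrite addr0 (pihomog_homog _ (hM i)) eqxx.
rewrite (pihomog_homog _ (hM j)) ifN //; apply: contraNneq ne_j => eq_ij.
by apply/eqP/val_inj.
Qed.

(** * The action of matrices on polynomials *)

HB.instance Definition _ (k : fieldType) n (M : 'M[k]_n) :=
  GRing.RMorphism.copy (mpoly_act M)
    (comp_mpoly [tuple \sum_j (invmx M i j) *: 'X_j | i < n]).
HB.instance Definition _ (k : fieldType) n (M : 'M[k]_n) :=
  GRing.Linear.copy (mpoly_act M)
    (comp_mpoly [tuple \sum_j (invmx M i j) *: 'X_j | i < n]).

Section MatrixAction.

Variables (k : fieldType) (n : nat).
Implicit Types (M N : 'M[k]_n) (p : {mpoly k[n]}).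

Lemma mpoly_actX M i : mpoly_act M 'X_i = \sum_j invmx M i j *: 'X_j.
Proof. by rewrite /mpoly_act comp_mpolyX1 tnth_mktuple. Qed.

Lemma mpoly_actC M c : mpoly_act M c%:MP = c%:MP.
Proof. exact: comp_mpolyC. Qed.

Lemma mpoly_act1 p : mpoly_act 1%:M p = p.
Proof.
rewrite -[RHS]comp_mpoly_id /mpoly_act; congr (p \mPo _).
apply: eq_from_tnth => i; rewrite !tnth_mktuple invmx1 (bigD1 i) //= big1 => [|j].
  by rewrite mxE eqxx scale1r addr0.
by rewrite mxE eq_sym => /negPf->; rewrite scale0r.
Qed.

Lemma mpoly_act_mul M N p : M \in unitmx -> N \in unitmx ->
  mpoly_act (M *m N) p = mpoly_act M (mpoly_act N p).
Proof.
move=> uM uN; elim/(@mpoly_subring_ind k n): p => [c|i|p q IHp IHq|p q IHp IHq].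
- by rewrite !mpoly_actC.
- rewrite [in RHS]mpoly_actX linear_sum mpoly_actX.
  have uMN : M *m N \in unitmx by rewrite unitmx_mul uM.
  have -> : invmx (M *m N) = invmx N *m invmx M.
    by rewrite -[RHS](mulmxK uMN) -(mulmxA (invmx N)) (mulmxA (invmx M)) mulVmx // mul1mx mulVmx // mul1mx.
  rewrite (eq_bigr (fun l => \sum_j (invmx N i j * invmx M j l) *: 'X_l)) => [|l _].
    rewrite exchange_big; apply: eq_bigr => j _; rewrite linearZ /= mpoly_actX.
    by rewrite scaler_sumr; apply: eq_bigr => l _; rewrite scalerA.
  by rewrite mxE scaler_suml.
- by rewrite !raddfD /= IHp IHq.
by rewrite !rmorphM /= IHp IHq.
Qed.

Lemma mcoeff0_linear (a : 'I_n -> k) : (\sum_j a j *: 'X_j : {mpoly k[n]})@_0 = 0.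
Proof.
rewrite raddf_sum big1 // => j _.
by rewrite /= mcoeffZ mcoeffX mnm1_eq0 mulr0.
Qed.

Lemma mcoeff1_linear (a : 'I_n -> k) i :
  (\sum_j a j *: 'X_j : {mpoly k[n]})@_U_(i) = a i.
Proof.
rewrite raddf_sum (bigD1 i) //= mcoeffZ mcoeffXU eqxx mulr1.
by rewrite big1 ?addr0 // => l ne_l; rewrite mcoeffZ mcoeffXU (negPf ne_l) mulr0.
Qed.

Lemma mpoly_act_mcoeff0 M p : (mpoly_act M p)@_0 = p@_0.
Proof. by apply: mcoeff0_comp => i; rewrite tnth_mktuple mcoeff0_linear. Qed.

Lemma mpoly_act_homog (mf : measure n) M p e :
    (forall i j, invmx M i j != 0 -> mf U_(i)%MM = mf U_(j)%MM) ->
  p \is e.-homog for mf -> mpoly_act M p \is e.-homog for mf.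
Proof.
move=> Mmf; apply: comp_mpoly_homog => i; rewrite tnth_mktuple rpred_sum // => j _.
have [-> | nz_Mij] := eqVneq (invmx M i j) 0; first by rewrite scale0r rpred0.
by rewrite rpredZ // dhomogX (Mmf i j).
Qed.

Lemma mpoly_act_msize M p : (msize (mpoly_act M p) <= msize p)%N.
Proof.
rewrite {1}[p]mpolyE linear_sum (leq_trans (msize_sum _ _ _)) //.
rewrite big_seq; apply/bigmax_leqP_seq => m pm _.
rewrite linearZ /= (leq_trans (msizeZ_le _ _)) //.
have hXm : mpoly_act M 'X_[m] \is (mdeg m).-homog.
  by apply: mpoly_act_homog => [i j _|]; rewrite ?dhomogX //= !mdeg1.
rewrite msizeE; apply/bigmax_leqP_seq => m' /(dhomog_mf hXm) -> _.
exact: msize_mdeg_lt.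
Qed.

(** Commuting with the grading at t = 2 suffices, since the powers of 2 are distinct in
    characteristic 0: elements of [GLgrad] mix only coordinates of equal weight. *)
Lemma GLgrad_inv_entry d M i j : [pchar k] =i pred0 ->
  GLgrad d M -> invmx M i j != 0 -> d i = d j.
Proof.
move=> char0 [uM Mgr] nz_ij.
have nz2 : (2%:R : k) != 0 by have := char0 2%N; rewrite inE /= => ->.
have gr : grading_mx d 2%:R *m invmx M = invmx M *m grading_mx d 2%:R.
  by rewrite -[LHS](mulKmx uM) (mulmxA M) Mgr // mulmxK.
have := congr1 (fun A : 'M_n => A i j) gr.
rewrite /grading_mx mul_diag_mx mul_mx_diag !mxE mulrC => /(mulfI nz_ij) /eqP.
rewrite -!natrX => eq2.
suff : (2 ^ d i == 2 ^ d j)%N by rewrite eqn_exp2l // => /eqP.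
have natr_inj (a b : nat) : (a <= b)%N -> (a%:R : k) == b%:R -> a == b.
  move=> le_ab; rewrite eq_sym -subr_eq0 -natrB // => eq0.
  have /pcharf0P/(_ (b - a)%N) := char0; rewrite eq0 => h.
  by rewrite eqn_leq le_ab -subn_eq0 -h.
case: (leqP (2 ^ d i) (2 ^ d j))%N => [|/ltnW] le2; first exact: natr_inj.
by rewrite eq_sym natr_inj // eq_sym.
Qed.

Lemma pihomog_act d M p i : [pchar k] =i pred0 -> GLgrad d M ->
  pihomog (wdeg d) i (mpoly_act M p) = mpoly_act M (pihomog (wdeg d) i p).
Proof.
move=> char0 grM; apply: pihomog_comp => j; rewrite tnth_mktuple.
apply: rpred_sum => l _; have [-> | nz_Mjl] := eqVneq (invmx M j l) 0.
  by rewrite scale0r rpred0.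
by rewrite rpredZ // (GLgrad_inv_entry char0 grM nz_Mjl) homog_X.
Qed.

End MatrixAction.

(** * Invariants and the Reynolds operator *)

Section Invariants.

Variables (k : fieldType) (n : nat) (gT : finGroupType) (rho : gT -> 'M[k]_n).
Variable H : {set gT}.
Implicit Types p q : {mpoly k[n]}.

Local Notation act w := (mpoly_act (rho w)).
Local Notation inv := (Defs.invariant rho H).

Lemma invariantC c : inv c%:MP.
Proof. by move=> g _; rewrite mpoly_actC. Qed.

Lemma subspace_invariant : subspace inv.
Proof.
split=> [g _|p q ip iq g Hg|c p ip g Hg]; first by rewrite raddf0.
  by rewrite raddfD /= ip ?iq.
by rewrite linearZ /= ip.
Qed.

Lemma invariantM p q : inv p -> inv q -> inv (p * q).
Proof. by move=> ip iq g Hg; rewrite rmorphM /= ip ?iq. Qed.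

Lemma invariant_mPo m (f : m.-tuple {mpoly k[n]}) (p : {mpoly k[m]}) :
  (forall i, inv (tnth f i)) -> inv (p \mPo f).
Proof.
have [i0 iD iZ] := subspace_invariant.
move=> invf; elim/(@mpoly_subring_ind k m): p => [c|i|p q IHp IHq|p q IHp IHq].
- by rewrite comp_mpolyC; apply: invariantC.
- by rewrite comp_mpolyX1.
- by rewrite comp_mpolyD; apply: iD.
by rewrite comp_mpolyM; apply: invariantM.
Qed.

Variable d : 'I_n -> nat.
Hypotheses (char0 : [pchar k] =i pred0) (d_gt0 : forall i, (0 < d i)%N).
Hypothesis rho_gr : forall h, h \in H -> GLgrad d (rho h).

Lemma invariant_pihomog p i : inv p -> inv (pihomog (wdeg d) i p).
Proof. by move=> ip h Hh; rewrite -pihomog_act ?ip //; apply: rho_gr. Qed.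

Lemma invariant_plusP p : invariant_plus d rho H p <-> inv p /\ p@_0 = 0.
Proof.
apply: irrelevantP => //; first exact: subspace_invariant.
by move=> q i; apply: invariant_pihomog.
Qed.

Lemma subspace_invariant_plus : subspace (invariant_plus d rho H).
Proof.
have [i0 iD iZ] := subspace_invariant.
split=> [|p q|c p]; rewrite !invariant_plusP; first by rewrite mcoeff0.
  by move=> [ip p0] [iq q0]; rewrite mcoeffD p0 q0 addr0; split=> //; apply: iD.
by move=> [ip p0]; rewrite mcoeffZ p0 mulr0; split=> //; apply: iZ.
Qed.

Lemma invariant_plusM p q : inv p -> invariant_plus d rho H q ->
  invariant_plus d rho H (p * q).
Proof.
rewrite !invariant_plusP => ip [iq q0].
by rewrite mcoeff0M q0 mulr0; split=> //; apply: invariantM.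
Qed.

Lemma subspace_invariant_plus2 : subspace (invariant_plus2 d rho H).
Proof. exact/subspace_ideal_mul/subspace_invariant_plus. Qed.

Lemma invariant_plus_sub p : inv p -> invariant_plus d rho H (p - (p@_0)%:MP).
Proof.
move=> ip; rewrite invariant_plusP mcoeffB mcoeffC eqxx mulr1 subrr; split=> //.
by apply: (subspace_sub subspace_invariant) => //; apply: invariantC.
Qed.

Lemma invariant_plus2_plus p : invariant_plus2 d rho H p -> invariant_plus d rho H p.
Proof.
have [i0 iD iZ] := subspace_invariant_plus.
move: p; apply: ideal_mul_elim => // a b /invariant_plusP[ia _]; exact: invariant_plusM.
Qed.

End Invariants.

Section GroupAction.

Variables (k : fieldType) (n : nat) (gT : finGroupType) (W : {group gT}).
Variables (rho : mx_representation k W n) (H : {group gT}).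
Hypotheses (char0 : [pchar k] =i pred0) (sHW : H \subset W).
Implicit Types p q : {mpoly k[n]}.

Local Notation act w := (mpoly_act (rho w)).
Local Notation inv := (Defs.invariant rho H).

Let HW h : h \in H -> h \in W. Proof. exact: subsetP. Qed.

Lemma act1g p : act 1%g p = p.
Proof. by rewrite repr_mx1 mpoly_act1. Qed.

Lemma actMg g h p : g \in W -> h \in W -> act (g * h)%g p = act g (act h p).
Proof. by move=> Wg Wh; rewrite repr_mxM // mpoly_act_mul ?repr_mx_unit. Qed.

Lemma card_neq0 : (#|H|%:R : k) != 0.
Proof. by have /pcharf0P-> := char0; rewrite -lt0n cardG_gt0. Qed.

Definition transfer p := \sum_(h in H) act h p.

Definition reynolds p := (#|H|%:R : k)^-1 *: transfer p.

Lemma transferD p q : transfer (p + q) = transfer p + transfer q.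
Proof. by rewrite -big_split; apply: eq_bigr => h _; rewrite raddfD. Qed.

Lemma transfer_inv p : inv (transfer p).
Proof.
move=> g Hg; rewrite raddf_sum /= [RHS](reindex_inj (mulgI g)) /=.
by apply: eq_big => [h|h Hh]; rewrite ?groupMl // actMg ?HW.
Qed.

Lemma transferMl t p : inv t -> transfer (t * p) = t * transfer p.
Proof.
by move=> it; rewrite mulr_sumr; apply: eq_bigr => h Hh; rewrite rmorphM /= it.
Qed.

Lemma reynoldsD p q : reynolds (p + q) = reynolds p + reynolds q.
Proof. by rewrite /reynolds transferD scalerDr. Qed.

Lemma reynolds0 : reynolds 0 = 0.
Proof. by rewrite /reynolds /transfer big1 ?scaler0 // => h _; rewrite raddf0. Qed.

Lemma reynolds_inv p : inv (reynolds p).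
Proof. by have [_ _ iZ] := subspace_invariant rho H; apply/iZ/transfer_inv. Qed.

Lemma reynoldsMl t p : inv t -> reynolds (t * p) = t * reynolds p.
Proof. by move=> it; rewrite /reynolds transferMl // scalerAr. Qed.

Lemma reynoldsMr t p : inv t -> reynolds (p * t) = reynolds p * t.
Proof. by move=> it; rewrite mulrC reynoldsMl // mulrC. Qed.

Lemma reynolds_id p : inv p -> reynolds p = p.
Proof.
move=> ip; rewrite /reynolds /transfer (eq_bigr (fun=> p)) => [|h Hh]; last exact: ip.
by rewrite sumr_const -scaler_nat scalerA mulVf ?scale1r // card_neq0.
Qed.

Lemma reynolds_sum I (s : seq I) (P : pred I) F :
  reynolds (\sum_(i <- s | P i) F i) = \sum_(i <- s | P i) reynolds (F i).
Proof. by apply: (big_morph reynolds reynoldsD reynolds0). Qed.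

Lemma reynolds_mcoeff0 p : (reynolds p)@_0 = p@_0.
Proof.
rewrite mcoeffZ raddf_sum (eq_bigr (fun=> p@_0)) => [|h _]; last first.
  exact: mpoly_act_mcoeff0.
by rewrite sumr_const -[X in _ * X]mulr_natl mulrA mulVf ?mul1r // card_neq0.
Qed.

(* That is, A_+ F \cap A^H = (A^H_+)^2 for F the ideal of A generated by A^H_+. *)
Lemma reynolds_mul_invariant d p : (forall i, 0 < d i)%N ->
    (forall h, h \in H -> GLgrad d (rho h)) ->
  ideal_mul (fun a => a@_0 = 0) (invariant_plus d rho H) p ->
  invariant_plus2 d rho H (reynolds p).
Proof.
move=> d_gt0 gr; move: p; apply: ideal_mul_elim => [|p q|a b a0 ib].
- by rewrite reynolds0; apply: ideal_mul0.
- by rewrite reynoldsD; apply: ideal_mulD.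
have /(invariant_plusP char0 d_gt0 gr)[invb _] := ib.
rewrite reynoldsMr //; apply: ideal_mul_prod => //.
rewrite invariant_plusP // reynolds_mcoeff0; split=> //; exact: reynolds_inv.
Qed.

Hypothesis rho_faithful : mx_faithful rho.

Lemma act_distinct g h : g \in W -> h \in W -> g != h -> exists p, act g p != act h p.
Proof.
move=> Wg Wh /eqP ne_gh; apply: NNPP => /not_ex_all_not eq_gh; case: ne_gh.
apply: (mx_faithful_inj rho_faithful) => //.
apply: (inv_inj (@invmxK _ n)); apply/matrixP=> i j.
have /negP := eq_gh 'X_i; rewrite negbK !mpoly_actX => /eqP.
by move/(congr1 (mcoeff U_(j)%MM)); rewrite !mcoeff1_linear.
Qed.

Lemma act_independence (c : gT -> {mpoly k[n]}) :
  (forall p, \sum_(w in W) c w * act w p = 0) -> forall w, w \in W -> c w = 0.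
Proof.
apply: (dedekind_independence (P := mem W)) => [w p q|w|g h Wg Wh].
- exact: rmorphM.
- exact: rmorph1.
exact: act_distinct.
Qed.

(** Galois correspondence: if w fixes every transfer over [H], the sums of the automorphisms over
    [H] and over the coset w H coincide, and independence of the automorphisms forces the coset to
    be [H]. *)
Lemma act_trivial_on_invariants w : w \in W ->
  (forall p, inv p -> act w p = p) -> w \in H.
Proof.
move=> Ww triv; apply: contraT => nHw.
suff /(_ _ (group1 W)) : forall x, x \in W ->
    (x \in H)%:R - (w^-1 * x \in H)%g%:R = 0 :> {mpoly k[n]}.
  by rewrite mulg1 groupV group1 (negPf nHw) subr0 => /eqP; rewrite oner_eq0.
apply: act_independence => p.
transitivity (transfer p - act w (transfer p)); last first.
  by rewrite (triv _ (transfer_inv p)) subrr.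
transitivity (\sum_(x in W) ((x \in H)%:R * act x p - (w^-1 * x \in H)%g%:R * act x p)).
  by apply: eq_bigr => x _; rewrite mulrBl.
rewrite sumrB; congr (_ - _).
  rewrite /transfer [RHS]big_mkcond [LHS]big_mkcond; apply: eq_bigr => x _.
  case: (boolP (x \in H)) => [/HW->|_]; first by rewrite mul1r.
  by rewrite mul0r if_same.
rewrite raddf_sum /= (reindex_inj (mulgI w)) [RHS]big_mkcond [LHS]big_mkcond /=.
apply: eq_bigr => x _; rewrite mulKg groupMl //.
case: (boolP (x \in H)) => [/HW Wx|_]; first by rewrite Wx mul1r actMg.
by rewrite mul0r if_same.
Qed.

End GroupAction.

(** * The rank of a polynomial algebra over its invariants *)

Section Rank.

Variables (k : fieldType) (n : nat) (gT : finGroupType) (W : {group gT}).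
Variables (rho : mx_representation k W n).
Hypotheses (char0 : [pchar k] =i pred0) (rho_faithful : mx_faithful rho).

Local Notation act w := (mpoly_act (rho w)).
Local Notation inv := (Defs.invariant rho W).

(** Nondegeneracy of the trace form: otherwise the conjugates of b would be the coefficients of a
    relation between the automorphisms. *)
Lemma transfer_nondegenerate b : b != 0 -> exists a, transfer rho W (a * b) != 0.
Proof.
move=> nz_b; apply: NNPP => /not_ex_all_not tr0; case/eqP: nz_b.
rewrite -(act1g rho b).
apply: (act_independence rho_faithful (c := fun w => act w b)) => // p.
have /negP := tr0 p; rewrite negbK => /eqP trp; rewrite -[RHS]trp.
by apply: eq_bigr => w _; rewrite mulrC rmorphM.
Qed.

(** Galois descent: when a relation survives conjugation of its coefficients, multiplying these by a
    suitable a and averaging over W makes them invariant, and [transfer_nondegenerate] keeps one of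
    them nonzero. *)
Lemma invariant_relation m l (z : 'I_m -> 'I_l -> {mpoly k[n]}) (b : 'I_m -> {mpoly k[n]}) :
    (forall w i, w \in W -> \sum_j act w (b j) * z j i = 0) -> (exists j, b j != 0) ->
  exists2 g : 'I_m -> {mpoly k[n]}, (forall j, inv (g j)) /\ (exists j, g j != 0)
    & forall i, \sum_j g j * z j i = 0.
Proof.
move=> bz [j0 /transfer_nondegenerate[a nz_a]].
exists (fun j => transfer rho W (a * b j)).
  by split; [move=> j; apply: transfer_inv | exists j0].
move=> i; rewrite (eq_bigr (fun j => \sum_(w in W) act w a * (act w (b j) * z j i))).
  rewrite exchange_big big1 // => w Ww /=.
  by rewrite -mulr_sumr bz ?mulr0.
move=> j _; rewrite mulr_suml; apply: eq_bigr => w _.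
by rewrite rmorphM /= mulrA.
Qed.

(** More than |W| elements satisfy, together with all their conjugates, a common relation. Moving
    the conjugate by w^-1 back by w gives the family of relations that [invariant_relation]
    descends. *)
Lemma invariant_free_le m (z : 'I_m -> {mpoly k[n]}) :
    (forall g : 'I_m -> {mpoly k[n]}, (forall j, inv (g j)) ->
       \sum_j g j * z j = 0 -> forall j, g j = 0) ->
  (m <= #|W|)%N.
Proof.
move=> freez; rewrite leqNgt; apply/negP=> lt_Wm.
have [v nz_v vM] :=
  wide_kernel (\matrix_(j < m, i < #|W|) act (enum_val i) (z j)) lt_Wm.
have [||g [ig [j nz_gj]] gz] :=
    @invariant_relation m 1 (fun j _ => z j) (fun j => v 0 j).
- move=> w _ Ww; have WVw : (w^-1)%g \in W by rewrite groupV.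
  have := congr1 (fun A : 'rV_#|W| => A 0 (enum_rank_in WVw w^-1%g)) vM.
  rewrite !mxE => /(congr1 (mpoly_act (rho w))); rewrite raddf0 => v0.
  rewrite -[RHS]v0 rmorph_sum; apply: eq_bigr => j _.
  by rewrite mxE enum_rankK_in // rmorphM /= -actMg // mulgV act1g.
- apply: NNPP => /not_ex_all_not v0; case/eqP: nz_v; apply/rowP=> j.
  by have /negP := v0 j; rewrite negbK mxE => /eqP.
by case/eqP: nz_gj; apply: freez => //; apply: gz ord0.
Qed.

End Rank.

(** * Reflections and linear forms *)

Section LinearForms.

Variables (k : fieldType) (n : nat).

Definition linear_form (r : 'rV[k]_n) : {mpoly k[n]} := \sum_j r 0 j *: 'X_j.

Lemma mcoeff_linear_form r j : (linear_form r)@_U_(j) = r 0 j.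
Proof.
exact: mcoeff1_linear.
Qed.

Lemma linear_form_eq0 r : (linear_form r == 0) = (r == 0).
Proof.
apply/eqP/eqP => [r0 | ->]; first by apply/rowP=> j; rewrite -mcoeff_linear_form r0 mcoeff0 mxE.
by rewrite /linear_form big1 // => j _; rewrite mxE scale0r.
Qed.

Lemma msize_linear_form r : r != 0 -> msize (linear_form r) = 2%N.
Proof.
move=> nz_r; apply/eqP; rewrite eqn_leq; apply/andP; split.
  rewrite (leq_trans (msize_sum _ _ _)) //; apply/bigmax_leqP => j _.
  by rewrite (leq_trans (msizeZ_le _ _)) // msizeX mdeg1.
have [j nz_rj] : exists j, r 0 j != 0.
  apply/existsP; apply: contraNT nz_r; rewrite negb_exists => /forallP r0.
  by apply/eqP/rowP=> j; rewrite mxE; apply/eqP; have := r0 j; rewrite negbK.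
have := @msize_mdeg_lt _ _ (linear_form r) U_(j)%MM.
by rewrite mdeg1; apply; rewrite mcoeff_msupp mcoeff_linear_form.
Qed.

Lemma is_reflectionE (M : 'M[k]_n) : is_reflection M = (\rank (M - 1%:M) == 1%N).
Proof.
rewrite /is_reflection mxrank_ker mxrank_tr.
have := rank_leq_row (M - 1%:M); case: (\rank _) => [|[|r]] /=.
- by rewrite subn0 eqn_leq ltnn.
- by move=> n_gt0; rewrite subn1 prednK // eqxx.
move=> le_n; rewrite subnSK // ltn_eqF // ltn_subrL /=; exact: leq_trans le_n.
Qed.

Lemma rank1_factor m (A : 'M[k]_(m, n)) : (\rank A <= 1)%N ->
  exists (c : 'cV[k]_m) (r : 'rV[k]_n), A = c *m r.
Proof.
have [-> _ | nz_A rkA] := eqVneq A 0; first by exists 0, 0; rewrite mulmx0.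
have [i nz_i] : exists i, row i A != 0.
  apply/existsP; apply: contraNT nz_A; rewrite negb_exists => /forallP A0.
  by apply/eqP/row_matrixP=> i; rewrite row0; apply/eqP; have := A0 i; rewrite negbK.
have /submxP[c cA] : (A <= row i A)%MS.
  rewrite -(mxrank_leqif_sup (row_sub i A)).
  have -> : \rank (row i A) = 1%N by apply/eqP; rewrite rank_rV nz_i.
  by rewrite eq_sym eqn_leq rkA lt0n mxrank_eq0.
by exists c, (row i A).
Qed.

End LinearForms.

Section ReflectionDivision.

Variables (k : fieldType) (n : nat).

(** The divided difference of a reflection. [invmx M - 1] is a column times a row, the row being an
    equation of the hyperplane; as p |-> M . p - p is a twisted derivation, divisibility is checked
    on the variables. The size bound drives Chevalley's induction. *)
Lemma reflection_divides (M : 'M[k]_n) : M \in unitmx -> is_reflection M ->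
  exists2 l : {mpoly k[n]}, l != 0 & forall p, exists2 q,
    mpoly_act M p - p = l * q & (msize q <= (msize p).-1)%N.
Proof.
move=> uM; rewrite is_reflectionE => /eqP rk1.
have eqA : invmx M - 1%:M = - invmx M *m (M - 1%:M).
  by rewrite mulmxBr mulmx1 mulNmx mulVmx // opprK addrC.
have [|c [r cr]] := @rank1_factor k n n (invmx M - 1%:M).
  by rewrite eqA -rk1 mxrankM_maxr.
have nz_r : r != 0.
  apply: contra_eqN rk1 => /eqP r0; have : M - 1%:M = 0.
    rewrite -[LHS](mulKVmx uM) -[X in M *m X]opprK -mulNmx -eqA cr r0 mulmx0.
    by rewrite oppr0 mulmx0.
  by move=> ->; rewrite mxrank0.
exists (linear_form r); first by rewrite linear_form_eq0.
move=> p; have [q eq_q] : exists q, mpoly_act M p - p = linear_form r * q.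
  elim/(@mpoly_subring_ind k n): p => [a|i|p q [p' Ep] [q' Eq]|p q [p' Ep] [q' Eq]].
  - by exists 0; rewrite mpoly_actC subrr mulr0.
  - exists (c i 0)%:MP; rewrite mulrC mul_mpolyC scaler_sumr mpoly_actX.
    rewrite -[X in _ - X](_ : \sum_j (1%:M : 'M_n) i j *: 'X_j = _); last first.
      rewrite (bigD1 i) //= mxE eqxx scale1r big1 ?addr0 // => j.
      by rewrite mxE eq_sym => /negPf->; rewrite scale0r.
    rewrite -sumrB; apply: eq_bigr => j _; rewrite -scalerBl scalerA.
    have := congr1 (fun B : 'M_n => B i j) cr.
    by rewrite !mxE big_ord1 => <-.
  - by exists (p' + q'); rewrite mulrDr -Ep -Eq raddfD opprD addrACA.
  exists (p' * mpoly_act M q + p * q').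
  rewrite mulrDr mulrA -Ep mulrCA -Eq rmorphM /= mulrBl mulrBr addrA subrK //.
exists q => //; have [-> | nz_q] := eqVneq q 0; first by rewrite msize0.
have := msizeM (_ : linear_form r != 0) nz_q; rewrite linear_form_eq0 => /(_ nz_r).
rewrite -eq_q msize_linear_form // => sz_q.
have : (msize (mpoly_act M p - p) <= msize p)%N.
  rewrite (leq_trans (msizeD_le _ _)) // geq_max mpoly_act_msize.
  by rewrite /= mmeasureN leqnn.
by rewrite sz_q; case: (msize p).
Qed.

End ReflectionDivision.

(** * Chevalley's theorem *)

Section Chevalley.

Variables (k : fieldType) (n : nat) (gT : finGroupType) (W : {group gT}).
Variables (rho : mx_representation k W n) (d : 'I_n -> nat).
Hypotheses (char0 : [pchar k] =i pred0) (d_gt0 : forall i, (0 < d i)%N).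
Hypothesis rho_gr : forall w, w \in W -> GLgrad d (rho w).
Hypothesis rho_faithful : mx_faithful rho.
Hypothesis rho_refl : <<[set w in W | is_reflection (rho w)]>>%g = W.

Local Notation act w := (mpoly_act (rho w)).
Local Notation inv := (Defs.invariant rho W).
Local Notation invp := (invariant_plus d rho W).
Local Notation invp2 := (invariant_plus2 d rho W).

(* Usually called the Hilbert ideal. *)
Definition invariant_ideal : {mpoly k[n]} -> Prop := ideal_mul (fun=> True) invp.

Local Notation F := invariant_ideal.

Let subF : subspace F.
Proof. by apply: subspace_ideal_mul. Qed.

Let invpP p : invp p <-> inv p /\ p@_0 = 0.
Proof. exact: invariant_plusP. Qed.

Lemma invariant_idealM a p : F p -> F (a * p).
Proof. exact: ideal_mulM. Qed.

Lemma invariant_ideal_invp p : invp p -> F p.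
Proof. by move=> ip; rewrite -[p]mul1r; apply: ideal_mul_prod. Qed.

Lemma act_invariant_ideal w p : w \in W -> F p -> F (act w p).
Proof.
have [F0 FD FZ] := subF.
move=> Ww; move: p; apply: ideal_mul_elim => [|p q|a b _ ib].
- by rewrite raddf0.
- by rewrite raddfD; apply: FD.
have [ivb _] := iffLR (invpP b) ib.
by rewrite rmorphM /= ivb //; apply: ideal_mul_prod.
Qed.

Lemma reflection_generated_mod_ideal p :
    (forall s, s \in W -> is_reflection (rho s) -> F (act s p - p)) ->
  forall w, w \in W -> F (act w p - p).
Proof.
have [F0 FD FZ] := subF.
move=> refl w; rewrite -{1}rho_refl => /gen_prodgP[l [c cS ->]].
suff [] : (\prod_(i < l) c i)%g \in W /\ F (act (\prod_(i < l) c i)%g p - p) by [].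
apply: (big_ind (fun w => w \in W /\ F (act w p - p))) => [|g h [Wg Fg] [Wh Fh]|i _].
- by rewrite group1 act1g subrr.
- split; first by rewrite groupM.
  rewrite (actMg _ _ Wg Wh).
  have -> : act g (act h p) - p = act g (act h p - p) + (act g p - p).
    by rewrite raddfB /= addrA subrK.
  by apply: FD => //; apply: act_invariant_ideal.
by have := cS i; rewrite inE => /andP[Wc rc]; split=> //; apply: refl.
Qed.

(** Chevalley's key lemma. The excluded case says that [g ord0] belongs to the ideal of the other
    g_j after localization at 0; the factor t, with nonzero constant term, takes care of
    inhomogeneous invariants. Modulo the Hilbert ideal, [f ord0] is fixed by all reflections, hence
    equals its average. *)
Lemma invariant_relation_head m (g f : 'I_m.+1 -> {mpoly k[n]}) :
    (forall j, inv (g j)) ->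
    ~ (exists t (h : 'I_m -> {mpoly k[n]}), [/\ inv t, t@_0 != 0, forall j, inv (h j)
         & t * g ord0 = \sum_j h j * g (lift ord0 j)]) ->
  \sum_j g j * f j = 0 -> F (f ord0).
Proof.
have [F0 FD FZ] := subF.
move=> ig nrel; move: {2}(msize _) (leqnn (msize (f ord0))) => N.
elim: N f => [|N IHN] f leN gf0.
  by move: leN; rewrite leqn0 msize_poly_eq0 => /eqP->.
(* Applying a reflection to the relation and dividing the difference by the linear form gives a
   relation with the same g_j and a smaller first coefficient. *)
have Fact s : s \in W -> is_reflection (rho s) -> F (act s (f ord0) - f ord0).
  move=> Ws rs; have [l nz_l lP] := reflection_divides (repr_mx_unit rho Ws) rs.
  have /fin_all_exists2[q Eq leq_q] := fun j => lP (f j).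
  rewrite Eq; apply: invariant_idealM; apply: IHN.
    by rewrite (leq_trans (leq_q _)) // -ltnS; case: (msize _) leN.
  apply: (mulfI nz_l); rewrite mulr0 mulr_sumr.
  transitivity (act s (\sum_j g j * f j) - \sum_j g j * f j); last first.
    by rewrite gf0 raddf0 subrr.
  rewrite raddf_sum -sumrB; apply: eq_bigr => j _ /=.
  by rewrite rmorphM /= ig // -mulrBr Eq mulrCA.
have Favg : F (reynolds rho W (f ord0) - f ord0).
  rewrite -[X in _ - X]scale1r -(mulVf (card_neq0 W char0)) -scalerA -scalerBr.
  apply: FZ; rewrite scaler_nat -sumr_const -sumrB; apply: subspace_sum => // w Ww.
  exact: reflection_generated_mod_ideal.
have iR := @reynolds_inv _ _ _ _ rho W (subxx W) (f ord0).
have [R0 | nz_R0] := eqVneq (reynolds rho W (f ord0))@_0 0.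
  rewrite -[f ord0](subKr (reynolds rho W (f ord0))).
  apply: subspace_sub => //; apply: invariant_ideal_invp; exact/invpP.
(* If the average of [f ord0] does not vanish at 0, the averaged relation is an instance of the
   excluded case. *)
case: nrel; exists (reynolds rho W (f ord0)).
exists (fun j => - reynolds rho W (f (lift ord0 j))); split=> // [j|].
  by apply: subspace_opp (subspace_invariant rho W) _ _; apply: reynolds_inv.
have := congr1 (reynolds rho W) gf0; rewrite reynolds0 reynolds_sum big_ord_recl.
rewrite reynoldsMl // => /eqP; rewrite addr_eq0 mulrC => /eqP->.
rewrite -sumrN; apply: eq_bigr => j _; rewrite reynoldsMl //.
by rewrite mulNr mulrC.
Qed.

(* Chevalley's argument for the freeness of A over A^W, for vectors. *)
Lemma free_over_invariants l m (z : 'I_m -> 'I_l -> {mpoly k[n]}) :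
    (forall a : 'I_m -> k, (forall i, F (\sum_j a j *: z j i)) -> forall j, a j = 0) ->
  forall g : 'I_m -> {mpoly k[n]}, (forall j, inv (g j)) ->
    (forall i, \sum_j g j * z j i = 0) -> forall j, g j = 0.
Proof.
have [F0 FD FZ] := subF.
elim: m z => [|m IHm] z freez g ig gz0 j; first by case: j.
have [[t [h [it nz_t ih tg]]] | nrel] := classic (exists t (h : 'I_m -> {mpoly k[n]}),
    [/\ inv t, t@_0 != 0, forall j, inv (h j)
         & t * g ord0 = \sum_j h j * g (lift ord0 j)]); last first.
  have /freez/(_ ord0) : forall i, F (\sum_j (j == ord0)%:R *: z j i).
    move=> i; rewrite big_ord_recl scale1r big1 ?addr0 => [|j' _]; last first.
      by rewrite scale0r.
    exact: (invariant_relation_head ig nrel (f := fun j => z j i)).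
  by move/eqP; rewrite oner_eq0.
have nz_t' : t != 0 by apply: contraNneq nz_t => ->; rewrite mcoeff0.
(* Multiplying the relation by t and replacing [t * g ord0] eliminates [g ord0]: the other g_j
   satisfy a relation between the [z']. *)
pose z' j i := t * z (lift ord0 j) i + h j * z ord0 i.
have g0 : forall j, g (lift ord0 j) = 0.
  apply: (IHm z') => // [a Fa|i].
    (* Modulo the Hilbert ideal, t and the h_j reduce to their constant terms, so a combination of
       the [z'] is one of the z with coefficients [a']. *)
    pose a' j := oapp (fun j' => t@_0 * a j') (\sum_j' a j' * (h j')@_0) (unlift ord0 j).
    have /freez a'0 : forall i, F (\sum_j a' j *: z j i).
      move=> i; rewrite big_ord_recl /a' unlift_none /=.
      rewrite (eq_bigr (fun j => (t@_0 * a j) *: z (lift ord0 j) i)) => [|j' _].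
        2: by rewrite liftK.
      have := Fa i; rewrite /z'.
      have -> : \sum_j a j *: (t * z (lift ord0 j) i + h j * z ord0 i) =
          (\sum_j' a j' * (h j')@_0) *: z ord0 i
           + \sum_i0 (t@_0 * a i0) *: z (lift ord0 i0) i
           + \sum_j a j *: ((t - (t@_0)%:MP) * z (lift ord0 j) i
                            + (h j - ((h j)@_0)%:MP) * z ord0 i).
        rewrite scaler_suml -!big_split; apply: eq_bigr => j' _ /=.
        by rewrite -!mul_mpolyC !mpolyCM; ring.
      move=> FF.
      rewrite -[X in F X](addrK (\sum_j a j *: ((t - (t@_0)%:MP) * z (lift ord0 j) i
                            + (h j - ((h j)@_0)%:MP) * z ord0 i))).
      apply: subspace_sub => //.
      apply: subspace_sum => // j' _; apply: FZ; apply: FD.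
        rewrite mulrC; apply: invariant_idealM; apply: invariant_ideal_invp.
        exact: invariant_plus_sub.
      rewrite mulrC; apply: invariant_idealM; apply: invariant_ideal_invp.
      exact: invariant_plus_sub.
    move=> j'; have := a'0 (lift ord0 j'); rewrite /a' liftK /= => /eqP.
    by rewrite mulf_eq0 (negPf nz_t) => /eqP.
  rewrite /z'; have := congr1 (fun x => t * x) (gz0 i); rewrite mulr0 => gz.
  rewrite -[RHS]gz big_ord_recl mulrDr mulrA tg mulr_suml mulr_sumr -big_split.
  by apply: eq_bigr => j' _ /=; rewrite mulrDr addrC !mulrA (mulrC (h j')) (mulrC t).
case: (unliftP ord0 j) => [j' ->|->]; first exact: g0.
apply: (mulfI nz_t'); rewrite mulr0 tg big1 // => j' _.
by rewrite g0 mulr0.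
Qed.

End Chevalley.

(** * Generators of the algebra of invariants *)

Section Generation.

Variables (k : fieldType) (n : nat) (gT : finGroupType) (W : {group gT}).
Variables (rho : mx_representation k W n) (d : 'I_n -> nat).
Hypotheses (char0 : [pchar k] =i pred0) (d_gt0 : forall i, (0 < d i)%N).
Hypothesis rho_gr : forall w, w \in W -> GLgrad d (rho w).

Local Notation act w := (mpoly_act (rho w)).
Local Notation inv := (Defs.invariant rho W).
Local Notation invp := (invariant_plus d rho W).
Local Notation invp2 := (invariant_plus2 d rho W).
Local Notation hc := (pihomog (wdeg d)).

Implicit Types p q : {mpoly k[n]}.

Definition generated_by m (f : m.-tuple {mpoly k[n]}) (p : {mpoly k[n]}) : Prop :=
  exists P : {mpoly k[m]}, p = P \mPo f.

Lemma generated_byD m (f : m.-tuple {mpoly k[n]}) p q :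
  generated_by f p -> generated_by f q -> generated_by f (p + q).
Proof. by move=> [P ->] [Q ->]; exists (P + Q); rewrite comp_mpolyD. Qed.

Lemma generated_byM m (f : m.-tuple {mpoly k[n]}) p q :
  generated_by f p -> generated_by f q -> generated_by f (p * q).
Proof. by move=> [P ->] [Q ->]; exists (P * Q); rewrite comp_mpolyM. Qed.

Lemma generated_byC m (f : m.-tuple {mpoly k[n]}) c : generated_by f c%:MP.
Proof. by exists c%:MP; rewrite comp_mpolyC. Qed.

Lemma generated_by0 m (f : m.-tuple {mpoly k[n]}) : generated_by f 0.
Proof. by exists 0; rewrite comp_mpoly0. Qed.

Lemma generated_by_gen m (f : m.-tuple {mpoly k[n]}) i : generated_by f (tnth f i).
Proof. by exists 'X_i; rewrite comp_mpolyX1. Qed.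

Lemma generated_by_sum m (f : m.-tuple {mpoly k[n]}) I (s : seq I) (P : pred I) F :
  (forall i, P i -> generated_by f (F i)) -> generated_by f (\sum_(i <- s | P i) F i).
Proof.
by move=> gF; apply: big_ind => //; [apply: generated_by0 | apply: generated_byD].
Qed.

(** Graded Nakayama: in degree N, an invariant minus a combination of the f_i is a sum of products
    of invariants of positive, hence smaller, degree. *)
Lemma generated_by_homog_span m (f : m.-tuple {mpoly k[n]}) (e : 'I_m -> nat) :
    (forall i, tnth f i \is (e i).-homog for (wdeg d)) ->
    (forall p, invp p -> in_span_mod invp2 (tnth f) p) ->
  forall p, inv p -> generated_by f p.
Proof.
move=> hf spanf.
suff gen N p : inv p -> generated_by f (hc N p).
  move=> p ip; have [N NP] := homog_components d p.
  by rewrite (NP N) //; apply: generated_by_sum => i _; apply: gen.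
elim/ltn_ind: N p => N IHN p ip; have [->|N_gt0] := posnP N.
  by rewrite pihomog0_mcoeff //; apply: generated_byC.
have ihcp : inv (hc N p) by apply: invariant_pihomog.
have /spanf[a Sq] : invp (hc N p).
  rewrite invariant_plusP //; split=> //.
  exact: homog_mcoeff0 N_gt0 (pihomogP _ _ _).
rewrite -(pihomog_id (wdeg d) N) -(subrK (\sum_i a i *: tnth f i) (hc N p)).
rewrite raddfD /=; apply: generated_byD; last first.
  rewrite raddf_sum; apply: generated_by_sum => i _ /=.
  rewrite linearZ /= -mul_mpolyC; apply: generated_byM; first exact: generated_byC.
  rewrite (pihomog_homog _ (hf i)); case: ifP => _; last exact: generated_by0.
  exact: generated_by_gen.
move: (hc N p - _) Sq; apply: ideal_mul_elim => [|p1 p2|q1 q2].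
- by rewrite raddf0; apply: generated_by0.
- by rewrite raddfD; apply: generated_byD.
rewrite !invariant_plusP // => -[iq1 q10] [iq2 q20].
rewrite pihomogM; apply: generated_by_sum => -[i lt_iN] _ /=.
have [->|i_gt0] := posnP i.
  by rewrite pihomog0_mcoeff // q10 mul0r; apply: generated_by0.
have [->|ne_iN] := eqVneq i N.
  by rewrite subnn (pihomog0_mcoeff q2) // q20 mulr0; apply: generated_by0.
apply: generated_byM; apply: IHN => //; first by rewrite ltn_neqAle ne_iN -ltnS.
by rewrite ltn_subrL i_gt0.
Qed.

Lemma ideal_mul_pihomog (P Q : {mpoly k[n]} -> Prop) p N :
    (forall q i, P q -> P (hc i q)) -> (forall q i, Q q -> Q (hc i q)) ->
  ideal_mul P Q p -> ideal_mul P Q (hc N p).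
Proof.
move=> hP hQ; move: p; apply: ideal_mul_elim => [|p1 p2|a b Pa Qb].
- by rewrite raddf0; apply: ideal_mul0.
- by rewrite raddfD; apply: ideal_mulD.
rewrite pihomogM; apply: big_ind => [||i _]; [exact: ideal_mul0 | exact: ideal_mulD |].
by apply: ideal_mul_prod; [apply: hP | apply: hQ].
Qed.

Lemma mcoeff0_pihomog p N : p@_0 = 0 -> (hc N p)@_0 = 0.
Proof.
move=> p0; have [-> | N_gt0] := posnP N; first by rewrite pihomog0_mcoeff // mcoeffC p0 mul0r.
exact: homog_mcoeff0 N_gt0 (pihomogP _ _ _).
Qed.

Lemma invariant_plus_pihomog p N : invp p -> invp (hc N p).
Proof.
rewrite !invariant_plusP // => -[ip p0]; split; last exact: mcoeff0_pihomog.
exact: invariant_pihomog.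
Qed.

(* By Euler's formula. *)
Lemma gradient_in_invariant_ideal p : invp p ->
  (forall i, invariant_ideal rho d p^`M(i)) -> invp2 p.
Proof.
move=> ip Fp; have [inv_p p0] := iffLR (invariant_plusP char0 d_gt0 rho_gr p) ip.
pose M := ideal_mul (fun a : {mpoly k[n]} => a@_0 = 0) invp.
have subM : subspace M.
  apply: subspace_ideal_mul; split=> [|a b a0 b0|c a a0]; first exact: mcoeff0.
    by rewrite mcoeffD a0 b0 addr0.
  by rewrite mcoeffZ a0 mulr0.
have [M0 MD MZ] := subM.
have ME : M (\sum_j (d j)%:R *: ('X_j * p^`M(j))).
  apply: subspace_sum => // j _; apply: MZ; move: (p^`M(j)) (Fp j).
  apply: ideal_mul_elim => [|q1 q2|a b _ ib]; first by rewrite mulr0.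
    by rewrite mulrDr; apply: MD.
  rewrite mulrA; apply: ideal_mul_prod => //.
  by rewrite mcoeff0M mcoeffX mnm1_eq0 mul0r.
suff Mp : M p by rewrite -(reynolds_id char0 inv_p); apply: reynolds_mul_invariant.
have [N NP] := homog_components d p; rewrite (NP N) //.
apply: subspace_sum => // -[i lt_iN] _ /=.
have [->|i_gt0] := posnP i; first by rewrite pihomog0_mcoeff // p0 mpolyC0.
have nz_i : (i%:R : k) != 0 by have /pcharf0P-> := char0; rewrite -lt0n.
rewrite -[hc i p]scale1r -(mulVf nz_i) -scalerA; apply: MZ.
have -> : i%:R *: hc i p = hc i (\sum_j (d j)%:R *: ('X_j * p^`M(j))).
  pose E q := \sum_j (d j)%:R *: ('X_j * q^`M(j)) : {mpoly k[n]}.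
  have ED : {morph E : q1 q2 / q1 + q2}.
    move=> q1 q2; rewrite /E -big_split; apply: eq_bigr => j _.
    by rewrite mderivD mulrDr scalerDr.
  have E0 : E 0 = 0 by rewrite /E big1 // => j _; rewrite mderiv0 mulr0 scaler0.
  rewrite -/(E p) {2}(NP N) // (big_morph E ED E0) [RHS](linear_sum (hc i)) /=.
  rewrite [RHS](bigD1 (Ordinal lt_iN)) //= [X in _ + X]big1 => [|j ne_j].
     rewrite addr0 /E (euler_mpoly (pihomogP (wdeg d) i p)) linearZ /=.
    by rewrite pihomog_id.
  rewrite /E (euler_mpoly (pihomogP (wdeg d) j p)) linearZ /=.
  rewrite (pihomog_homog _ (pihomogP (wdeg d) j p)) ifN ?scaler0 //.
  by apply: contraNneq ne_j => eq_ij; apply/eqP/val_inj.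
apply: ideal_mul_pihomog => // q j; [exact: mcoeff0_pihomog | exact: invariant_plus_pihomog].
Qed.

(** By the chain rule, the gradient of an invariant is the conjugate of itself times the constant
    matrix [invmx (rho w)]; conjugating the coefficients of a relation therefore gives a
    relation. *)
Lemma act_gradient_relation s (f b : 'I_s -> {mpoly k[n]}) :
    (forall j, inv (f j)) -> (forall i, \sum_j b j * (f j)^`M(i) = 0) ->
  forall w i, w \in W -> \sum_j act w (b j) * (f j)^`M(i) = 0.
Proof.
move=> invf bf w i Ww.
have df j : (f j)^`M(i) = \sum_l act w ((f j)^`M(l)) * (invmx (rho w) l i)%:MP.
  rewrite -{1}(invf j w Ww) /mpoly_act mderiv_comp; apply: eq_bigr => l _.
  congr (_ * _); rewrite tnth_mktuple raddf_sum (bigD1 i) //= big1 => [|l' ne_l'].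
    by rewrite mderivZ mderiv_var eqxx addr0 -mul_mpolyC mulr1.
  by rewrite mderivZ mderiv_var (negPf ne_l') scaler0.
rewrite (eq_bigr (fun j => \sum_l act w (b j * (f j)^`M(l)) * (invmx (rho w) l i)%:MP)).
  rewrite exchange_big big1 // => l _ /=.
  by rewrite -mulr_suml -raddf_sum bf raddf0 mul0r.
move=> j _; rewrite {1}df mulr_sumr; apply: eq_bigr => l _.
by rewrite rmorphM /= mulrA.
Qed.

Hypothesis rho_faithful : mx_faithful rho.
Hypothesis rho_refl : <<[set w in W | is_reflection (rho w)]>>%g = W.

(** A dependence descends to one with invariant coefficients, and [free_over_invariants] reduces it
    to constant combinations of gradients with entries in the Hilbert ideal. By Euler's formula the
    same combination of the f_j is then in (A^W_+)^2. *)
Lemma gradients_free s (f : 'I_s -> {mpoly k[n]}) :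
    (forall j, invp (f j)) -> free_mod invp2 f ->
  forall b : 'I_s -> {mpoly k[n]}, (forall i, \sum_j b j * (f j)^`M(i) = 0) ->
  forall j, b j = 0.
Proof.
move=> ipf freef b bf; apply: NNPP => /not_all_ex_not[j0 /eqP nz_b].
have invf j : inv (f j) by have [] := iffLR (invariant_plusP char0 d_gt0 rho_gr _) (ipf j).
have [||g [ig [j nz_g]] gf] :=
    @invariant_relation _ _ _ _ rho rho_faithful s n (fun j i => (f j)^`M(i)) b.
- by move=> w i; apply: act_gradient_relation.
- by exists j0.
case/eqP: nz_g.
apply: (free_over_invariants char0 d_gt0 rho_gr rho_refl (z := fun j i => (f j)^`M(i))) => //.
move=> a Fa; apply: freef; apply: gradient_in_invariant_ideal => [|i].
  have [_ _ iZ] := subspace_invariant_plus char0 d_gt0 rho_gr.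
  by apply: (subspace_sum (subspace_invariant_plus char0 d_gt0 rho_gr)) => l _; apply: iZ.
by rewrite raddf_sum (eq_bigr _ (fun l _ => mderivZ _ _ _)).
Qed.

Lemma free_invariants_le s (f : 'I_s -> {mpoly k[n]}) :
  (forall j, invp (f j)) -> free_mod invp2 f -> (s <= n)%N.
Proof.
move=> ipf freef; rewrite leqNgt; apply/negP=> lt_ns.
have [v nz_v vM] := wide_kernel (\matrix_(j, i) (f j)^`M(i)) lt_ns.
case/eqP: nz_v; apply/rowP=> j; rewrite mxE.
apply: (gradients_free ipf freef (b := fun j => v 0 j)) => i.
have := congr1 (fun A : 'rV_n => A 0 i) vM; rewrite !mxE => vM0; rewrite -[RHS]vM0.
by apply: eq_bigr => l _; rewrite mxE.
Qed.

(** Finiteness comes from [free_invariants_le]: a maximal homogeneous family independent modulo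
    (A^W_+)^2 has at most n elements, and spanning modulo (A^W_+)^2 it generates. *)
Lemma basic_invariants_exist : exists s (f : s.-tuple {mpoly k[n]}) (e : 'I_s -> nat),
  [/\ (s <= n)%N,
      forall i, invp (tnth f i) /\ tnth f i \is (e i).-homog for (wdeg d),
      free_mod invp2 (tnth f),
      forall p, invp p -> in_span_mod invp2 (tnth f) p
    & forall p, inv p -> generated_by f p].
Proof.
have subS := subspace_invariant_plus2 char0 d_gt0 rho_gr.
have [|s [f [le_sn ipf freef spanf]]] := maximal_free_mod subS (N := n)
    (Q := fun q => invp q /\ exists e, q \is e.-homog for (wdeg d)).
  by move=> m v ipv; apply: free_invariants_le => j; have [] := ipv j.
have /fin_all_exists[e hf] := fun i => (ipf i).2.
have ft : tnth [tuple f i | i < s] =1 f by move=> i; rewrite tnth_mktuple.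
exists s, [tuple f i | i < s], e; set ff := mktuple _ in ft *.
have freeff : free_mod invp2 (tnth ff).
  by move=> a Sa; apply: freef; rewrite (eq_bigr (fun i => a i *: tnth ff i)) // => i; rewrite ft.
have homff i : tnth ff i \is (e i).-homog for (wdeg d) by rewrite ft.
have spanff p : invp p -> in_span_mod invp2 (tnth ff) p.
  have [S0 SD SZ] := subspace_in_span_mod subS (tnth ff).
  case=> t tP ->; rewrite big_seq; apply: (subspace_sum (subspace_in_span_mod subS (tnth ff))).
  move=> q /tP[iq [m m_gt0 hq]]; have [|a Sa] := spanf q.
    split; last by exists m.
    by rewrite invariant_plusP //; split=> //; apply: homog_mcoeff0 hq.
  by exists a; rewrite (eq_bigr (fun i => a i *: f i)) // => i; rewrite ft.
split=> // [i|]; first by split; rewrite // ft; have [] := ipf i.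
exact: generated_by_homog_span homff spanff.
Qed.

End Generation.

(** * Jacobians of invariants *)

Definition jacobian (k : fieldType) n m (f : m.-tuple {mpoly k[n]}) :
    'M[{mpoly k[n]}]_(m, n) :=
  \matrix_(j, i) (tnth f j)^`M(i).

Lemma jacobian_comp (k : fieldType) n m l (P : l.-tuple {mpoly k[m]})
    (f : m.-tuple {mpoly k[n]}) :
  jacobian [tuple tnth P j \mPo f | j < l]
    = map_mx (comp_mpoly f) (jacobian P) *m jacobian f.
Proof.
apply/matrixP=> j i; rewrite !mxE tnth_mktuple mderiv_comp.
by apply: eq_bigr => a _; rewrite !mxE.
Qed.

Section Jacobian.

Variables (k : fieldType) (n : nat).

Lemma msize_mderiv (p : {mpoly k[n]}) i N : (msize p <= N.+1)%N -> (msize p^`M(i) <= N)%N.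
Proof.
move=> le_pN; rewrite msizeE; apply/bigmax_leqP_seq => m; rewrite mcoeff_msupp mcoeff_mderiv.
move=> nz_pm _; have : (m + U_(i))%MM \in msupp p.
  by rewrite mcoeff_msupp; apply: contraNneq nz_pm => ->; rewrite mul0rn.
move/msize_mdeg_lt; rewrite mdegD mdeg1 addn1 => /leq_trans/(_ le_pN).
by rewrite ltnS.
Qed.

Lemma mderiv_eq0_const (p : {mpoly k[n]}) : [pchar k] =i pred0 ->
  (forall i, p^`M(i) = 0) -> p = (p@_0)%:MP.
Proof.
move=> /pcharf0P char0 dp0; apply/mpolyP=> m; rewrite mcoeffC.
have [-> | nz_m] := eqVneq m 0%MM; first by rewrite mulr1.
rewrite mulr0; have [i nz_mi] : exists i, m i != 0%N.
  apply/existsP; apply: contraNT nz_m; rewrite negb_exists => /forallP m0.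
  by apply/eqP/mnmP=> i; rewrite mnm0E; apply/eqP; have := m0 i; rewrite negbK.
have := mcoeff_mderiv i p (m - U_(i))%MM; rewrite dp0 mcoeff0 submK; last first.
  by rewrite lep1mP.
by move/esym/eqP; rewrite -mulr_natr mulf_eq0 char0 orbF => /eqP.
Qed.

(** The partial derivatives of a relation, evaluated at f, form a vector killed by the Jacobian
    matrix; they are thus relations of smaller size, and characteristic 0 leaves only a constant. *)
Lemma jacobian_algebraic_independence (f : n.-tuple {mpoly k[n]}) (P : {mpoly k[n]}) :
  [pchar k] =i pred0 -> \det (jacobian f) != 0 -> P \mPo f = 0 -> P = 0.
Proof.
move=> char0 nz_J; move: {2}(msize P) (leqnn (msize P)) => N.
elim: N P => [|N IHN] P leN Pf0; first by apply/eqP; rewrite -msize_poly_eq0 -leqn0.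
suff dP i : P^`M(i) = 0.
  move: Pf0; rewrite (mderiv_eq0_const char0 dP) comp_mpolyC => /eqP.
  by rewrite mpolyC_eq0 => /eqP->; rewrite mpolyC0.
apply: IHN; first exact: msize_mderiv.
pose v : 'rV_n := \row_j (P^`M(j) \mPo f).
suff /rowP/(_ i) : v = 0 by rewrite !mxE.
apply/eqP; apply: contraNT nz_J => nz_v; apply/det0P; exists v => //.
apply/rowP=> l; rewrite !mxE; transitivity (P \mPo f)^`M(l); last first.
  by rewrite Pf0 mderiv0.
by rewrite mderiv_comp; apply: eq_bigr => j _; rewrite !mxE.
Qed.

Variables (gT : finGroupType) (W H : {group gT}) (rho : mx_representation k W n).
Hypotheses (char0 : [pchar k] =i pred0) (sHW : H \subset W).

Local Notation act w := (mpoly_act (rho w)).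
Local Notation invH := (Defs.invariant rho H).

Let HW h : h \in H -> h \in W. Proof. exact: subsetP. Qed.

(* The function w |-> \sum b * act w s, for the element \sum b (x) s of A (x) A^H. *)
Definition twisted_eval (L : seq ({mpoly k[n]} * {mpoly k[n]})) w :=
  \sum_(x <- L) x.1 * act w x.2.

Definition represented (F : gT -> {mpoly k[n]}) : Prop :=
  exists2 L : seq ({mpoly k[n]} * {mpoly k[n]}),
    forall x, x \in L -> invH x.2 & forall w, w \in W -> twisted_eval L w = F w.

Lemma represented1 : represented (fun=> 1).
Proof.
exists [:: (1, 1)] => [x|w Ww]; last by rewrite /twisted_eval big_seq1 /= rmorph1 mulr1.
by rewrite inE => /eqP->; rewrite -mpolyC1; apply: invariantC.
Qed.

Lemma representedM F1 F2 : represented F1 -> represented F2 ->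
  represented (fun w => F1 w * F2 w).
Proof.
move=> [L1 iL1 E1] [L2 iL2 E2].
exists [seq (x.1 * y.1, x.2 * y.2) | x <- L1, y <- L2] => [z|w Ww].
  by move/allpairsP=> [[x y] /= [xL yL ->]] /=; apply: invariantM; [apply: iL1 | apply: iL2].
rewrite -E1 // -E2 // /twisted_eval big_allpairs_dep mulr_suml; apply: eq_bigr => x _.
by rewrite mulr_sumr; apply: eq_bigr => y _; rewrite /= rmorphM mulrACA.
Qed.

Lemma represented_prod I (s : seq I) (P : pred I) F :
  (forall i, P i -> represented (F i)) -> represented (fun w => \prod_(i <- s | P i) F i w).
Proof.
move=> rF; elim: s => [|i s IHs].
  by have [L iL E] := represented1; exists L => // w Ww; rewrite big_nil E.
have [Pi | nPi] := boolP (P i).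
  have [L iL E] := representedM (rF i Pi) IHs; exists L => // w Ww.
  by rewrite big_cons Pi E.
by have [L iL E] := IHs; exists L => // w Ww; rewrite big_cons (negPf nPi) E.
Qed.

(** The product is the value at v c of the orbit polynomial of c under [H], transformed by w; its
    coefficients are images under w of elements of A^H. *)
Lemma represented_norm v c :
  represented (fun w => \prod_(h in H) (act v c - act (w * h)%g c)).
Proof.
have [P EP] : exists P : {poly {mpoly k[n]}}, P = \prod_(h in H) ('X - (act h c)%:P).
  by eexists.
have actP w : w \in W ->
    map_poly (act w) P = \prod_(h in H) ('X - (act (w * h)%g c)%:P).
  move=> Ww; rewrite EP rmorph_prod; apply: eq_bigr => h Hh /=.
  by rewrite rmorphB /= map_polyX map_polyC /= actMg // HW.
exists [seq (act v c ^+ i, P`_i) | i <- iota 0 (size P)] => [x|w Ww].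
  move=> /mapP[i _ ->] g Hg; rewrite [LHS](esym (coef_map (act g) P i)) (actP g (HW Hg)).
  apply: (congr1 (fun q : {poly {mpoly k[n]}} => q`_i)); rewrite EP [RHS](reindex_inj (mulgI g)) /=.
  by apply: eq_bigl => h; rewrite groupMl.
rewrite /twisted_eval big_map -[size P]subn0 -/(index_iota 0 (size P)) big_mkord /=.
transitivity (map_poly (act w) P).[act v c].
  rewrite (@horner_coef_wide _ (size P)) ?size_poly //.
  by apply: eq_bigr => i _; rewrite coef_map mulrC.
by rewrite actP // horner_prod; apply: eq_bigr => h _; rewrite hornerXsubC.
Qed.

Definition separator (c : gT -> {mpoly k[n]}) :=
  \prod_(v in W :\: H) \prod_(h in H) (act v (c v) - act h (c v)).

(** A product of norms over the v outside [H]. For w in [H], translation by w permutes the factors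
    of each norm; for w outside, the factor with v = w and h = 1 vanishes. *)
Lemma represented_separator c :
  represented (fun w => if w \in H then separator c else 0).
Proof.
have [|L iL E] := @represented_prod _ (enum (W :\: H)) xpredT
    (fun v w => \prod_(h in H) (act v (c v) - act (w * h)%g (c v))).
  by move=> v _; apply: represented_norm.
exists L => // w Ww; rewrite E // big_enum /=.
have [Hw | nHw] := boolP (w \in H).
  apply: eq_bigr => v _; rewrite [RHS](reindex_inj (mulgI w)) /=.
  by apply: eq_bigl => h; rewrite groupMl.
rewrite (bigD1 w) ?inE ?nHw //= [X in X * _](bigD1 1%g) ?group1 //=.
by rewrite mulg1 subrr !mul0r.
Qed.

Variables (m : nat) (f : m.-tuple {mpoly k[n]}).
Hypothesis genf : forall p, Defs.invariant rho W p -> generated_by f p.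

(** The A-module spanned by the gradients of the generators; by the chain rule it contains the
    gradient of every W-invariant. *)
Definition in_gradient_span (v : 'I_n -> {mpoly k[n]}) : Prop :=
  exists N : 'I_m -> {mpoly k[n]}, forall i, v i = \sum_j N j * (tnth f j)^`M(i).

Lemma in_gradient_span_transfer p :
  in_gradient_span (fun i => (transfer rho W p)^`M(i)).
Proof.
have /genf[Q ->] := transfer_inv rho (subxx W) p.
by exists (fun j => Q^`M(j) \mPo f) => i; rewrite mderiv_comp.
Qed.

Lemma in_gradient_spanD v1 v2 : in_gradient_span v1 -> in_gradient_span v2 ->
  in_gradient_span (fun i => v1 i + v2 i).
Proof.
move=> [N1 E1] [N2 E2]; exists (fun j => N1 j + N2 j) => i.
by rewrite E1 E2 -big_split; apply: eq_bigr => j _; rewrite mulrDl.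
Qed.

Lemma in_gradient_spanM a v : in_gradient_span v -> in_gradient_span (fun i => a * v i).
Proof.
move=> [N E]; exists (fun j => a * N j) => i.
by rewrite E mulr_sumr; apply: eq_bigr => j _; rewrite mulrA.
Qed.

Lemma in_gradient_span_sum (I : Type) (s : seq I) (F : I -> 'I_n -> {mpoly k[n]}) :
  (forall x, in_gradient_span (F x)) -> in_gradient_span (fun i => \sum_(x <- s) F x i).
Proof.
move=> sF; elim: s => [|x s [N E]].
  by exists (fun=> 0) => i; rewrite big_nil big1 // => j _; rewrite mul0r.
have [N' E'] := in_gradient_spanD (sF x) (ex_intro _ N E).
by exists N' => i; rewrite big_cons E'.
Qed.

(* Averaging b * act w (s p), for an element \sum b (x) s of A (x) A^H whose values vanish to second order at w \notin H, isolates the derivative of p. *)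
Lemma separator_gradient c p : invH p ->
  in_gradient_span (fun i => separator c ^+ 2 * p^`M(i)).
Proof.
move=> ip; have [L iL EL] := represented_separator c; set u := separator c in EL *.
(* With [L] taken twice, each term of the Leibniz rule keeps an undifferentiated factor
   [twisted_eval L w], which is 0 for w outside [H]. *)
pose T q i := \sum_(x <- L) \sum_(y <- L)
  (x.1 * y.1) * (transfer rho W (x.2 * y.2 * q))^`M(i).
have spanT q : in_gradient_span (T q).
  do 2![apply: in_gradient_span_sum => ?]; apply: in_gradient_spanM.
  exact: in_gradient_span_transfer.
pose D w i := \sum_(x <- L) x.1 * (act w x.2)^`M(i).
have ET q i : invH q -> T q i =
    q * (\sum_(w in H) (u * D w i) *+ 2) + (u ^+ 2 * q^`M(i)) *+ #|H|.
  move=> iq; pose ev w := if w \in H then u else 0.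
  transitivity (\sum_(w in W) ((ev w * D w i) *+ 2 * act w q + ev w ^+ 2 * (act w q)^`M(i))).
    rewrite /T (eq_bigr (fun x => \sum_(y <- L) \sum_(w in W)
        (x.1 * y.1) * (act w x.2 * act w y.2 * act w q)^`M(i))) => [|x _]; last first.
      apply: eq_bigr => y _; rewrite -mulr_sumr raddf_sum /=; congr (_ * _).
      by apply: eq_bigr => w _; rewrite !rmorphM.
    rewrite (eq_bigr (fun x => \sum_(w in W) \sum_(y <- L)
        (x.1 * y.1) * (act w x.2 * act w y.2 * act w q)^`M(i))) => [|x _]; last first.
      by rewrite exchange_big.
    rewrite exchange_big; apply: eq_bigr => w Ww /=.
    rewrite /ev -EL // mulr2n mulrDl.
    have -> : twisted_eval L w * D w i * act w q =
        \sum_(x <- L) \sum_(y <- L) (x.1 * y.1) * (act w x.2 * (act w y.2)^`M(i) * act w q).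
      rewrite /twisted_eval /D !mulr_suml; apply: eq_bigr => x _.
      rewrite mulr_sumr mulr_suml; apply: eq_bigr => y _.
      by move: (act w x.2) (_^`M(_)) (act w q) => ? ? ?; ring.
    have {1}-> : \sum_(x <- L) \sum_(y <- L) (x.1 * y.1) * (act w x.2 * (act w y.2)^`M(i) * act w q)
       = \sum_(x <- L) \sum_(y <- L) (x.1 * y.1) * ((act w x.2)^`M(i) * act w y.2 * act w q).
      rewrite exchange_big; apply: eq_bigr => x _; apply: eq_bigr => y _.
      by move: (act w y.2) (_^`M(_)) (act w q) => ? ? ?; ring.
    have -> : twisted_eval L w ^+ 2 * (act w q)^`M(i) =
        \sum_(x <- L) \sum_(y <- L) (x.1 * y.1) * (act w x.2 * act w y.2 * (act w q)^`M(i)).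
      rewrite expr2 /twisted_eval !mulr_suml; apply: eq_bigr => x _.
      rewrite mulr_sumr mulr_suml; apply: eq_bigr => y _.
      by move: (act w x.2) (act w y.2) (_^`M(_)) => ? ? ?; ring.
    rewrite -!big_split; apply: eq_bigr => x _ /=.
    rewrite -!big_split; apply: eq_bigr => y _ /=.
    rewrite !mderivM.
    move: (act w x.2) (act w y.2) (act w q) => a1 a2 a3.
    by move: (a1^`M(i)) (a2^`M(i)) (a3^`M(i)) => ? ? ?; ring.
  rewrite (bigID (mem H)) /= [X in _ + X]big1 => [|w /andP[_ /negPf nHw]]; last first.
    by rewrite /ev nHw !mul0r mul0rn mul0r expr0n mul0r addr0.
  rewrite addr0 (eq_bigl (mem H)) => [|w]; last first.
    by apply/andP/idP => [[]|Hw] //; rewrite HW.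
  rewrite (eq_bigr (fun w => q * ((u * D w i) *+ 2) + u ^+ 2 * q^`M(i))) => [|w Hw].
    by rewrite big_split sumr_const -mulr_sumr.
  have Hw' : w \in H by [].
  by rewrite /ev Hw' iq // mulrC.
(* [T p - p * T 1] cancels the terms where p is not differentiated and leaves #|H| times u^2 grad
   p. *)
have [N EN] := in_gradient_spanM (#|H|%:R^-1)%:MP
  (in_gradient_spanD (spanT p) (in_gradient_spanM (- p) (spanT 1))).
exists N => i; rewrite -EN ET // ET; last by rewrite -mpolyC1; apply: invariantC.
rewrite -mpolyC1 mderivC mulr0 mul0rn addr0 mpolyC1 mul1r mulNr addrAC subrr add0r.
rewrite mul_mpolyC -scaler_nat scalerA mulVf ?scale1r //.
exact: card_neq0.
Qed.

End Jacobian.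

Lemma det_mulmx_inj (R : idomainType) m n (A : 'M[R]_(m, n)) (J : 'M[R]_n) :
  \det J != 0 -> A *m J = 0 -> A = 0.
Proof.
move=> nz_J AJ; have /matrixP A0 : A *m J *m \adj J = 0 by rewrite AJ mul0mx.
apply/matrixP=> i j; have := A0 i j.
rewrite -mulmxA mul_mx_adj mul_mx_scalar !mxE => /eqP.
by rewrite mulf_eq0 (negPf nz_J) => /eqP.
Qed.

Section Generators.

Variables (k : fieldType) (n : nat) (gT : finGroupType) (W : {group gT}).
Variables (rho : mx_representation k W n).
Hypotheses (char0 : [pchar k] =i pred0) (rho_faithful : mx_faithful rho).
Variables (m : nat) (f : m.-tuple {mpoly k[n]}).
Hypothesis genf : forall p, Defs.invariant rho W p -> generated_by f p.

(** [separator_gradient] for the trivial subgroup and the coordinate functions, whose gradients form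
    the identity matrix. The separator is nonzero because each c v is moved by v. *)
Lemma jacobian_left_inverse :
  exists2 D : {mpoly k[n]}, D != 0 & exists N : 'M_(n, m), N *m jacobian f = D%:M.
Proof.
have /fin_all_exists[c cP] : forall v, exists c : {mpoly k[n]}, v \in W :\: 1%G ->
    mpoly_act (rho v) c != c.
  move=> v; have [|_] := boolP (v \in W :\: 1%G); last by exists 0.
  rewrite !inE => /andP[ne_v1 Wv].
  have [p np] := act_distinct rho_faithful Wv (group1 W) ne_v1.
  by exists p; rewrite act1g in np.
have nz_s : separator 1%G rho c != 0.
  apply/prodf_neq0 => v Wv; apply/prodf_neq0 => h; rewrite inE => /eqP->.
  by rewrite act1g subr_eq0 cP.
exists (separator 1%G rho c ^+ 2); first by rewrite expf_neq0.
have inv1 p : Defs.invariant rho 1%G p.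
  by move=> g; rewrite inE => /eqP->; rewrite act1g.
have /fin_all_exists[N NP] := fun l : 'I_n =>
  separator_gradient char0 (sub1G W) genf c (inv1 'X_l).
exists (\matrix_(l, j) N l j); apply/matrixP=> l i; rewrite !mxE.
rewrite (eq_bigr (fun j => N l j * (tnth f j)^`M(i))) => [|j _]; last by rewrite !mxE.
by rewrite -NP mderiv_var mulr_natr.
Qed.

Lemma generators_ge : (n <= m)%N.
Proof.
have [D nz_D [N ND]] := jacobian_left_inverse.
rewrite leqNgt; apply/negP=> /(wide_kernel N)[v nz_v vN].
have : v *m (N *m jacobian f) = 0 by rewrite mulmxA vN mul0mx.
rewrite ND mul_mx_scalar => /rowP v0; case/eqP: nz_v; apply/rowP=> i.
by have := v0 i; rewrite !mxE => /eqP; rewrite mulf_eq0 (negPf nz_D) => /eqP.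
Qed.

End Generators.

Lemma generators_jacobian_neq0 (k : fieldType) n (gT : finGroupType) (W : {group gT})
    (rho : mx_representation k W n) (f : n.-tuple {mpoly k[n]}) :
    [pchar k] =i pred0 -> mx_faithful rho ->
    (forall p, Defs.invariant rho W p -> generated_by f p) ->
  \det (jacobian f) != 0.
Proof.
move=> char0 faith genf; have [D nz_D [N ND]] := jacobian_left_inverse char0 faith genf.
have : \det N * \det (jacobian f) != 0 by rewrite -det_mulmx ND det_scalar expf_neq0.
by rewrite mulf_eq0 negb_or => /andP[].
Qed.

(** * Products of linear forms and generic linear forms *)

Section LinearFactors.

Variables (k : fieldType) (n : nat).
Implicit Types (r : 'rV[k]_n) (p q l : {mpoly k[n]}).

Definition mpoly_dvd l p : Prop := exists q, p = l * q.

(** Restriction to the hyperplane of r, solving its equation for the i-th coordinate. Divisibility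
    by the linear form becomes vanishing under a morphism to a domain, whence primality. *)
Definition eliminate r i : n.-tuple {mpoly k[n]} :=
  [tuple 'X_j - ((j == i)%:R / r 0 i) *: linear_form r | j < n].

Lemma eliminate_linear_form r i : r 0 i != 0 -> linear_form r \mPo eliminate r i = 0.
Proof.
move=> nz_ri; rewrite raddf_sum /=.
rewrite (eq_bigr (fun j => r 0 j *: 'X_j - (r 0 j * ((j == i)%:R / r 0 i)) *: linear_form r)).
  rewrite sumrB -scaler_suml (_ : \sum_j r 0 j * ((j == i)%:R / r 0 i) = 1).
    by rewrite scale1r subrr.
  rewrite (bigD1 i) //= eqxx big1 => [|j /negPf->]; last by rewrite mul0r mulr0.
  by rewrite addr0 mul1r mulfV.
by move=> j _; rewrite comp_mpolyZ comp_mpolyX1 tnth_mktuple scalerBr scalerA.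
Qed.

Lemma eliminate_mod r i p : mpoly_dvd (linear_form r) (p - (p \mPo eliminate r i)).
Proof.
elim/(@mpoly_subring_ind k n): p => [c|j|p q [p' Ep] [q' Eq]|p q [p' Ep] [q' Eq]].
- by exists 0; rewrite comp_mpolyC subrr mulr0.
- exists ((j == i)%:R / r 0 i)%:MP; rewrite comp_mpolyX1 tnth_mktuple opprB addrC subrK.
  by rewrite [RHS]mulrC mul_mpolyC.
- by exists (p' + q'); rewrite mulrDr -Ep -Eq comp_mpolyD opprD addrACA.
exists (p' * q + (p \mPo eliminate r i) * q').
rewrite comp_mpolyM mulrDr mulrA -Ep mulrCA -Eq mulrBl mulrBr.
by rewrite addrA subrK.
Qed.

Lemma eliminate_eq0 r i p : r 0 i != 0 ->
  p \mPo eliminate r i = 0 <-> mpoly_dvd (linear_form r) p.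
Proof.
move=> nz_ri; split=> [p0 | [q ->]].
  by have := eliminate_mod r i p; rewrite p0 subr0.
by rewrite comp_mpolyM eliminate_linear_form // mul0r.
Qed.

Lemma row_neq0 r : r != 0 -> exists i, r 0 i != 0.
Proof.
move=> nz_r; apply/existsP; apply: contraNT nz_r; rewrite negb_exists => /forallP r0.
by apply/eqP/rowP=> j; rewrite mxE; apply/eqP; have := r0 j; rewrite negbK.
Qed.

Lemma linear_form_prime r p q : r != 0 -> mpoly_dvd (linear_form r) (p * q) ->
  mpoly_dvd (linear_form r) p \/ mpoly_dvd (linear_form r) q.
Proof.
move=> /row_neq0[i nz_ri]; rewrite -!(eliminate_eq0 _ nz_ri) comp_mpolyM.
by move/eqP; rewrite mulf_eq0 => /orP[]/eqP; [left | right].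
Qed.

Lemma linear_form_dvd r r' : r != 0 -> r' != 0 ->
  mpoly_dvd (linear_form r) (linear_form r') -> (r' <= r)%MS.
Proof.
move=> nz_r nz_r' [q Eq].
have nz_q : q != 0.
  by apply: contraNneq nz_r' => q0; rewrite -linear_form_eq0 Eq q0 mulr0.
have := msizeM (_ : linear_form r != 0) nz_q; rewrite linear_form_eq0 => /(_ nz_r).
rewrite -Eq !msize_linear_form // => -[/esym sz_q].
have q_const : q = (q@_0)%:MP by apply: msize1_polyC; rewrite -[X in (X <= _)%N]add0n sz_q.
apply/submxP; exists (q@_0)%:M; rewrite mul_scalar_mx; apply/rowP=> j.
by rewrite mxE -!mcoeff_linear_form -mcoeffZ -mul_mpolyC -q_const mulrC -Eq.
Qed.

Definition splits_linearly (S : 'rV[k]_n -> Prop) p : Prop :=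
  exists2 s : seq 'rV[k]_n, forall r, r \in s -> S r & p = \prod_(r <- s) linear_form r.

Lemma splits_linearly1 S : splits_linearly S 1.
Proof. by exists [::]; rewrite ?big_nil. Qed.

Lemma splits_linearlyM S p q : splits_linearly S p -> splits_linearly S q -> splits_linearly S (p * q).
Proof.
move=> [s sS ->] [s' s'S ->]; exists (s ++ s'); last by rewrite big_cat.
by move=> r; rewrite mem_cat => /orP[/sS|/s'S].
Qed.

Lemma splits_linearly_prod S I (s : seq I) (P : pred I) F :
  (forall i, P i -> splits_linearly S (F i)) -> splits_linearly S (\prod_(i <- s | P i) F i).
Proof.
by move=> sF; apply: big_ind => //; [apply: splits_linearly1 | apply: splits_linearlyM].
Qed.

Lemma splits_linearly_exp S p j : splits_linearly S p -> splits_linearly S (p ^+ j).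
Proof.
move=> sp; elim: j => [|j IHj]; first by rewrite expr0; apply: splits_linearly1.
by rewrite exprS; apply: splits_linearlyM.
Qed.

Lemma splits_linearly_factor S p q : (forall r, S r -> r != 0) -> splits_linearly S (p * q) ->
  (msize p <= 1)%N \/ exists2 r, S r & mpoly_dvd (linear_form r) p.
Proof.
move=> nzS [s sS]; elim: s p q sS => [|r s IHs] p q sS Epq.
  left; rewrite big_nil in Epq.
  have /andP[nz_p nz_q] : (p != 0) && (q != 0).
    by rewrite -negb_or -mulf_eq0 Epq oner_eq0.
  have := msizeM nz_p nz_q; rewrite Epq msize1.
  have : msize q != 0%N by rewrite msize_poly_eq0.
  by case: (msize q) => [|j] //= _; rewrite addnS /= => ->; rewrite leq_addr.
have Sr : S r by apply: sS; rewrite mem_head.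
rewrite big_cons in Epq.
have [|//|[q' Eq]] := @linear_form_prime r p q (nzS r Sr).
- by exists (\prod_(j <- s) linear_form j).
- by right; exists r.
apply: (IHs p q') => [r' sr'|]; first by apply: sS; rewrite inE sr' orbT.
apply: (@mulfI _ (linear_form r)); first by rewrite linear_form_eq0 nzS.
by rewrite mulrCA -Eq.
Qed.

Lemma splits_linearly_dvd S r p : r != 0 -> (forall r', S r' -> r' != 0) ->
  splits_linearly S p -> mpoly_dvd (linear_form r) p -> exists2 r', S r' & (r' <= r)%MS.
Proof.
move=> nz_r nzS [s sS ->]; elim: s sS => [|r' s IHs] sS.
  rewrite big_nil => -[q Eq]; have := @msize1 n k; rewrite Eq.
  have nz_q : q != 0 by apply: contra_eqN Eq => /eqP->; rewrite mulr0 oner_eq0.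
  rewrite msizeM ?linear_form_eq0 // msize_linear_form // => /eqP.
  by rewrite eqSS msize_poly_eq0 (negPf nz_q).
have Sr' : S r' by apply: sS; rewrite mem_head.
rewrite big_cons => /(linear_form_prime nz_r)[dv|dv].
  by exists r' => //; apply: linear_form_dvd => //; apply: nzS.
by apply: IHs dv => r'' sr''; apply: sS; rewrite inE sr'' orbT.
Qed.

(** A nonconstant common divisor is divisible by a form of S1, which then divides a product of forms
    of S2 and is proportional to one of them. *)
Lemma coprime_splits_linearly S1 S2 p q1 q2 :
    (forall r, S1 r -> r != 0) -> (forall r, S2 r -> r != 0) ->
    (forall r1 r2, S1 r1 -> S2 r2 -> ~~ (r2 <= r1)%MS) ->
  splits_linearly S1 (p * q1) -> splits_linearly S2 (p * q2) -> (msize p <= 1)%N.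
Proof.
move=> nz1 nz2 co s1 s2; have [//|[r1 S1r1 [p' Ep]]] := splits_linearly_factor nz1 s1.
have [|r2 S2r2 le21] := splits_linearly_dvd (nz1 _ S1r1) nz2 s2.
  by exists (p' * q2); rewrite mulrA -Ep.
by have := co _ _ S1r1 S2r2; rewrite le21.
Qed.

Definition moment_row (t : k) : 'rV[k]_n := \row_i t ^+ i.

(** On the moment curve each condition fails only at roots of a nonzero polynomial in t, built from
    a column of [A x]. In characteristic 0 the natural numbers below the size of the product of
    these polynomials give more values of t than it has roots. *)
Lemma moment_row_avoids (I : finType) (A : I -> 'M[k]_n) :
    [pchar k] =i pred0 -> (forall x, A x != 0) ->
  exists t, forall x, moment_row t *m A x != 0.
Proof.
move=> /pcharf0P char0 nzA.
have /fin_all_exists[ij nz_ij] x : exists ij : 'I_n * 'I_n, A x ij.1 ij.2 != 0.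
  have [i nz_i] : exists i, row i (A x) != 0.
    apply/existsP; apply: contraNT (nzA x); rewrite negb_exists => /forallP A0.
    by apply/eqP/row_matrixP=> i; rewrite row0; apply/eqP; have := A0 i; rewrite negbK.
  by have [j nz_j] := row_neq0 nz_i; exists (i, j); rewrite mxE in nz_j.
pose P x : {poly k} := \poly_(i < n) oapp (fun i' => A x i' (ij x).2) 0 (insub i).
have nzP x : P x != 0.
  apply: contraNneq (nz_ij x) => /(congr1 (fun p : {poly k} => p`_(ij x).1)).
  by rewrite coef_poly ltn_ord coef0 valK /= => ->.
have nzPP : \prod_x P x != 0 by apply/prodf_neq0.
pose Q := \prod_x P x; pose ts := [seq i%:R : k | i <- iota 0 (size Q)].
have [/allP all_roots | ] := boolP (all (root Q) ts).
  have natr_inj : injective (fun i : nat => i%:R : k).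
    move=> a b; wlog le_ab : a b / (a <= b)%N.
      by move=> wl eq_ab; case: (leqP a b) => [|/ltnW] le; [|apply/esym]; apply: wl.
    move=> eq_ab; apply/eqP; rewrite eqn_leq le_ab -subn_eq0 -char0 natrB //.
    by rewrite eq_ab subrr eqxx.
  have := max_poly_roots nzPP (introT allP all_roots).
  by rewrite map_inj_uniq ?iota_uniq // size_map size_iota ltnn => /(_ isT).
case/allPn=> t _ nroot; exists t => x; apply: contraNneq nroot => tA.
rewrite /root horner_prod (bigD1 x) //= mulf_eq0; apply/orP; left.
have := congr1 (fun B : 'rV_n => B 0 (ij x).2) tA; rewrite !mxE horner_poly => tA0.
rewrite -[X in _ == X]tA0; apply/eqP; apply: eq_bigr => i _.
by rewrite valK /= mxE mulrC.
Qed.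

Lemma act_linear_form (M : 'M[k]_n) r : mpoly_act M (linear_form r) = linear_form (r *m invmx M).
Proof.
rewrite raddf_sum /=.
rewrite (eq_bigr (fun i => \sum_j (r 0 i * invmx M i j) *: 'X_j)) => [|i _].
  rewrite exchange_big; apply: eq_bigr => j _; rewrite mxE scaler_suml.
  by apply: eq_bigr => i _.
rewrite linearZ /= mpoly_actX scaler_sumr.
by apply: eq_bigr => j _; rewrite scalerA.
Qed.

Lemma linear_formB r1 r2 : linear_form r1 - linear_form r2 = linear_form (r1 - r2).
Proof. by rewrite -sumrB; apply: eq_bigr => j _; rewrite !mxE scalerBl. Qed.

End LinearFactors.

(** * Serre's theorem *)

Section ReflectionSubgroup.

Variables (k : fieldType) (n : nat) (gT : finGroupType) (W : {group gT}).
Variables (rho : mx_representation k W n) (d : 'I_n -> nat).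
Hypotheses (char0 : [pchar k] =i pred0) (d_gt0 : forall i, (0 < d i)%N).
Hypothesis rho_gr : forall w, w \in W -> GLgrad d (rho w).
Hypothesis rho_faithful : mx_faithful rho.

Local Notation act w := (mpoly_act (rho w)).

Definition reflection_subgroup := <<[set w in W | is_reflection (rho w)]>>%G.

Local Notation H := reflection_subgroup.

Lemma reflection_subgroup_sub : H \subset W.
Proof. by rewrite gen_subG; apply/subsetP=> w; rewrite inE => /andP[]. Qed.

Let sHW := reflection_subgroup_sub.

(** Up to an invertible factor the difference is v^-1 h - 1; if its rank were at most 1, v^-1 h
    would be 1 or a reflection, and v would lie in [H]. *)
Lemma rank_diff_gt1 v h : v \in W -> v \notin H -> h \in H ->
  (1 < \rank (invmx (rho v) - invmx (rho h))%R)%N.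
Proof.
move=> Wv nHv Hh; have Wh := subsetP sHW _ Hh.
have uh := repr_mx_unit rho Wh.
have eq_rk : \rank (invmx (rho v) - invmx (rho h)) = \rank (rho (v^-1 * h)%g - 1%:M).
  rewrite -(mxrankMfree _ (_ : row_free (rho h))) ?row_free_unit //.
  by rewrite mulmxBl mulVmx // repr_mxM ?groupV // repr_mxV.
rewrite ltnNge; apply: contra nHv => rk1.
suff Hvh : (v^-1 * h)%g \in H by rewrite -groupV -(groupMr _ Hh).
have [-> | ne1] := eqVneq (v^-1 * h)%g 1%g; first exact: group1.
apply: mem_gen; rewrite inE is_reflectionE groupM ?groupV //= eqn_leq -eq_rk rk1 /=.
rewrite eq_rk lt0n mxrank_eq0 subr_eq0; apply: contra ne1 => /eqP r1.
by apply/eqP/(mx_faithful_inj rho_faithful); rewrite ?groupM ?groupV ?group1 // repr_mx1.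
Qed.

(* The factors of [separator H rho c] for the generic linear form [c] of parameter [t]. *)
Definition separator_row (t : k) (vh : gT * gT) : 'rV[k]_n :=
  moment_row n t *m (invmx (rho vh.1) - invmx (rho vh.2)).

Definition separator_rows (t : k) (r : 'rV[k]_n) : Prop :=
  exists2 vh : gT * gT, (vh.1 \in W :\: H) && (vh.2 \in H) & r = separator_row t vh.

Lemma separator_splits t :
  splits_linearly (separator_rows t) (separator H rho (fun=> linear_form (moment_row n t))).
Proof.
apply: splits_linearly_prod => v Wv; apply: splits_linearly_prod => h Hh.
exists [:: separator_row t (v, h)] => [r|].
  by rewrite inE => /eqP->; exists (v, h); rewrite //= Wv.
by rewrite big_seq1 !act_linear_form linear_formB -mulmxBr.
Qed.

Lemma separator_generic :
  exists t, forall r, separator_rows t r -> r != 0.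
Proof.
pose A vh := if (vh.1 \in W :\: H) && (vh.2 \in H) then
  invmx (rho vh.1) - invmx (rho vh.2) else 1%:M.
have [n0 | n_gt0] := posnP n.
  exists 0 => r [[v h] /= /andP[]]; rewrite inE => /andP[nHv Wv] Hh.
  by have lt1n := leq_trans (rank_diff_gt1 Wv nHv Hh) (rank_leq_row _); rewrite n0 in lt1n.
have [|t tP] := @moment_row_avoids k n _ A char0.
  move=> -[v h]; rewrite /A /=; case: ifP => [/andP[]|_].
    rewrite inE => /andP[nHv Wv] Hh; rewrite -mxrank_eq0 -lt0n.
    exact: ltnW (rank_diff_gt1 Wv nHv Hh).
  by rewrite -mxrank_eq0 mxrank1 -lt0n.
by exists t => r [vh Hvh ->]; have := tP vh; rewrite /A Hvh.
Qed.

(** A difference of rank at least 2 does not have its image in the line of a given row, so its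
    product with [cokermx] of that row is nonzero, and a generic t' avoids all proportionalities. *)
Lemma separator_coprime t : (forall r, separator_rows t r -> r != 0) ->
  exists2 t', forall r, separator_rows t' r -> r != 0 &
    forall r r', separator_rows t r -> separator_rows t' r' -> ~~ (r' <= r)%MS.
Proof.
move=> nz_t; pose ok vh := (vh.1 \in W :\: H) && (vh.2 \in H) : bool.
pose A (x : (gT * gT) * (gT * gT)) := if ok x.1 && ok x.2 then
  (invmx (rho x.2.1) - invmx (rho x.2.2)) *m cokermx (separator_row t x.1) else 1%:M.
have [n0 | n_gt0] := posnP n.
  have no t0 r : ~ separator_rows t0 r.
    move=> [[v h] /= /andP[]]; rewrite inE => /andP[nHv Wv] Hh _.
    by have lt1n := leq_trans (rank_diff_gt1 Wv nHv Hh) (rank_leq_row _); rewrite n0 in lt1n.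
  by exists 0 => [r|r r'] /no.
have [|t' tP] := @moment_row_avoids k n _ A char0.
  move=> [a [v h]]; rewrite /A /=; case: ifP => [/andP[_ /andP[]]|_]; last first.
    by rewrite -mxrank_eq0 mxrank1 -lt0n.
  rewrite inE => /andP[nHv Wv] Hh; rewrite -submxE; apply/negP=> /mxrankS le_rk.
  have := leq_trans (rank_diff_gt1 Wv nHv Hh) (leq_trans le_rk (rank_leq_row _)).
  by rewrite ltnn.
exists t' => [r [vh Hvh ->]|r r' [x Hx ->] [y Hy ->]].
  have := tP (vh, vh); rewrite /A /ok /= Hvh /= mulmxA.
  by apply: contraNneq; rewrite /separator_row => ->; rewrite mul0mx.
by have := tP (x, y); rewrite /A /ok /= Hx Hy /= mulmxA submxE.
Qed.

Local Notation rhoH := (subg_repr rho sHW).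
Local Notation invH := (Defs.invariant rho H).
Local Notation invpH := (invariant_plus d rho H).
Local Notation invp2H := (invariant_plus2 d rho H).

Let rhoH_gr h : h \in H -> GLgrad d (rhoH h).
Proof. by move=> Hh; apply/rho_gr/(subsetP sHW). Qed.

Let rhoH_faithful : mx_faithful rhoH.
Proof.
apply/subsetP=> h /rkerP[Hh r1]; apply: (subsetP rho_faithful).
by apply/rkerP; split; rewrite ?(subsetP sHW).
Qed.

Let rhoH_refl : <<[set h in H | is_reflection (rhoH h)]>>%g = H.
Proof.
apply/eqP; rewrite eqEsubset gen_subG; apply/andP; split.
  by apply/subsetP=> h; rewrite inE => /andP[].
rewrite gen_subG; apply/subsetP=> h Rh; apply: mem_gen; rewrite inE mem_gen //=.
by move: Rh; rewrite inE => /andP[].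
Qed.

(** Taylor's formula to first order. It reads the classes of polynomials in invariants modulo
    (A^H_+)^2 from linear parts. *)
Lemma first_order_expansion m (f : m.-tuple {mpoly k[n]}) (P : {mpoly k[m]}) :
    (forall i, invpH (tnth f i)) ->
  invp2H (P \mPo f - (P@_0)%:MP - \sum_i (P^`M(i))@_0 *: tnth f i).
Proof.
move=> ipf; have gr := rhoH_gr.
have invpP := invariant_plusP char0 d_gt0 rhoH_gr.
have subS : subspace invp2H := subspace_invariant_plus2 char0 d_gt0 rhoH_gr.
have subp : subspace invpH := subspace_invariant_plus char0 d_gt0 rhoH_gr.
have [S0 SD SZ] := subS; have [_ _ pZ] := subp.
have invf i : invH (tnth f i) by have [] := iffLR (invpP _) (ipf i).
elim/(@mpoly_subring_ind k m): P => [c|i|p q Sp Sq|p q Sp Sq].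
- rewrite comp_mpolyC mcoeffC eqxx mulr1 subrr big1 ?subrr // => i _.
  by rewrite mderivC mcoeff0 scale0r.
- rewrite comp_mpolyX1 mcoeffX mnm1_eq0 mpolyC0 subr0 (bigD1 i) //= big1 => [|j ne_j].
    by rewrite mderiv_var eqxx mcoeff1 eqxx scale1r addr0 subrr.
  by rewrite mderiv_var eq_sym (negPf ne_j) mcoeff0 scale0r.
- have -> : (p + q) \mPo f - ((p + q)@_0)%:MP - \sum_i ((p + q)^`M(i))@_0 *: tnth f i =
    (p \mPo f - (p@_0)%:MP - \sum_i (p^`M(i))@_0 *: tnth f i)
    + (q \mPo f - (q@_0)%:MP - \sum_i (q^`M(i))@_0 *: tnth f i); last exact: SD.
  rewrite (eq_bigr (fun i => (p^`M(i))@_0 *: tnth f i + (q^`M(i))@_0 *: tnth f i)).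
    rewrite big_split comp_mpolyD mcoeffD mpolyCD /=.
    by move: (_ \mPo _) (_ \mPo _) (_%:MP) (_%:MP) (\sum_i _) (\sum_i _) => *; ring.
  by move=> i _; rewrite mderivD mcoeffD scalerDl.
set Lp := \sum_i (p^`M(i))@_0 *: tnth f i in Sp.
set Lq := \sum_i (q^`M(i))@_0 *: tnth f i in Sq.
have ipq : invpH (q \mPo f - (q@_0)%:MP).
  have iq : invH (q \mPo f) by apply: invariant_mPo.
  have := invariant_plus_sub char0 d_gt0 rhoH_gr iq.
  rewrite mcoeff0_comp // => i; by have [] := iffLR (invpP _) (ipf i).
have -> : (p * q) \mPo f - ((p * q)@_0)%:MP - \sum_i ((p * q)^`M(i))@_0 *: tnth f i =
    (p \mPo f - (p@_0)%:MP - Lp) * (q \mPo f) + (p@_0) *: (q \mPo f - (q@_0)%:MP - Lq)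
     + Lp * (q \mPo f - (q@_0)%:MP).
  rewrite (eq_bigr (fun i => q@_0 *: ((p^`M(i))@_0 *: tnth f i)
                             + p@_0 *: ((q^`M(i))@_0 *: tnth f i))).
    rewrite big_split -!scaler_sumr -/Lp -/Lq comp_mpolyM mcoeff0M mpolyCM /=.
    rewrite -!mul_mpolyC.
    by move: (_ \mPo _) (_ \mPo _) (_%:MP) (_%:MP) (Lp) (Lq) => *; ring.
  move=> i _; rewrite mderivM mcoeffD !mcoeff0M scalerDl !scalerA.
  by rewrite (mulrC q@_0).
apply: (SD); first apply: (SD).
- rewrite mulrC; apply: ideal_mulM Sp => a ia.
  by apply: (invariant_plusM char0 d_gt0 rhoH_gr) => //; apply: invariant_mPo.
- exact: SZ.
by apply: ideal_mul_prod => //; apply: subspace_sum => // i _; apply: pZ.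
Qed.

Lemma serre_reflection_group m (f : m.-tuple {mpoly k[n]}) (e : 'I_m -> nat) :
    (m <= n)%N ->
    (forall i, invariant_plus d rho W (tnth f i) /\ tnth f i \is (e i).-homog for (wdeg d)) ->
    (forall p, Defs.invariant rho W p -> generated_by f p) ->
  <<[set w in W | is_reflection (rho w)]>>%g = W.
Proof.
move=> le_mn ihf genf.
have eq_mn : m = n by apply/eqP; rewrite eqn_leq le_mn (generators_ge char0 rho_faithful genf).
subst m; have invpP := invariant_plusP char0 d_gt0 rho_gr.
have invpPH := invariant_plusP char0 d_gt0 rhoH_gr.
have subS : subspace invp2H := subspace_invariant_plus2 char0 d_gt0 rhoH_gr.
have [s [th [e' [le_sn iht freet spant gent]]]] :=
  basic_invariants_exist char0 d_gt0 rhoH_gr rhoH_faithful rhoH_refl.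
have eq_sn : s = n.
  by apply/eqP; rewrite eqn_leq le_sn (generators_ge char0 rhoH_faithful gent).
subst s; have nz_Jt := generators_jacobian_neq0 char0 rhoH_faithful gent.
have ipt i : invpH (tnth th i) by have [] := iht i.
have th0 i : (tnth th i)@_0 = 0 by have [] := iffLR (invpPH _) (ipt i).
have invt i : invH (tnth th i) by have [] := iffLR (invpPH _) (ipt i).
have invW_H p : Defs.invariant rho W p -> invH p.
  by move=> ip h Hh; apply/ip/(subsetP sHW).
have /fin_all_exists[Phi EPhi] i : generated_by th (tnth f i).
  by apply/gent/invW_H; have [/invpP[]] := ihf i.
pose P := [tuple Phi i | i < n]; pose M := map_mx (comp_mpoly th) (jacobian P).
have EJ : jacobian f = M *m jacobian th.
  rewrite -jacobian_comp; congr jacobian; apply: eq_from_tnth => i.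
  by rewrite !tnth_mktuple EPhi.
(* With u the squared separator, [separator_gradient] gives N J(f) = u J(theta). Since J(f) = M
   J(theta), cancelling J(theta) gives N M = u, so det M divides u^n. *)
have dvd_sep t : exists q, \det M * q
    = (separator H rho (fun=> linear_form (moment_row n t)) ^+ 2) ^+ n.
  set u := separator _ _ _ ^+ 2.
  have /fin_all_exists[N NP] := fun l : 'I_n => separator_gradient char0 sHW genf
    (fun=> linear_form (moment_row n t)) (invt l).
  exists (\det (\matrix_(l, j) N l j)); rewrite mulrC -det_mulmx -det_scalar.
  congr determinant; apply/eqP; rewrite -subr_eq0; apply/eqP/(det_mulmx_inj nz_Jt).
  rewrite mulmxBl -mulmxA -EJ mul_scalar_mx; apply/eqP; rewrite subr_eq0; apply/eqP/matrixP=> l i.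
  by rewrite !mxE NP; apply: eq_bigr => j _; rewrite !mxE.
have [t1 nz_t1] := separator_generic.
have [t2 nz_t2 cop] := separator_coprime nz_t1.
have [[q1 Eq1] [q2 Eq2]] := (dvd_sep t1, dvd_sep t2).
have sp t : splits_linearly (separator_rows t)
    ((separator H rho (fun=> linear_form (moment_row n t)) ^+ 2) ^+ n).
  by do 2!apply: splits_linearly_exp; apply: separator_splits.
have small_det : (msize (\det M) <= 1)%N.
  apply: (coprime_splits_linearly nz_t1 nz_t2 cop (q1 := q1) (q2 := q2)).
    by rewrite Eq1.
  by rewrite Eq2.
have nz_det : \det M != 0.
  have [r rS Er] := sp t1; have nz_prod : \prod_(x <- r) linear_form x != 0.
    rewrite prodf_seq_neq0; apply/allP=> x xr /=; rewrite linear_form_eq0.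
    by apply: nz_t1; apply: rS.
  by apply: contraNneq nz_prod => det0; rewrite -Er -Eq1 det0 mul0r.
(* The linear part of f in terms of theta. Its determinant is the nonzero constant det M, so the f_i
   too span A^H_+ modulo (A^H_+)^2. *)
pose C : 'M[k]_n := \matrix_(i, j) ((Phi i)^`M(j))@_0.
have uC : C \in unitmx.
  have detC : \det C = (\det M)@_0.
    rewrite -[RHS](det_map_mx (mcoeff 0%MM : {rmorphism {mpoly k[n]} -> k})).
    by congr determinant; apply/matrixP=> i j; rewrite !mxE tnth_mktuple /= mcoeff0_comp.
  rewrite unitmxE unitfE detC; apply: contraNneq nz_det => det0.
  by rewrite (msize1_polyC small_det) det0 mpolyC0.
have spanf p : invpH p -> in_span_mod invp2H (tnth f) p.
  have [s0 sD sZ] := subspace_in_span_mod subS (tnth f).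
  have span_th i : in_span_mod invp2H (tnth f) (tnth th i).
    exists (fun j => invmx C i j).
    have -> : tnth th i - \sum_j invmx C i j *: tnth f j =
        - \sum_j invmx C i j *: (tnth f j - \sum_l C j l *: tnth th l).
      rewrite [X in _ = - X](eq_bigr (fun j => invmx C i j *: tnth f j
          - \sum_l (invmx C i j * C j l) *: tnth th l)) => [|j _].
        rewrite sumrB opprB [X in _ = X - _]exchange_big /=; congr (_ - _).
        rewrite (bigD1 i) //= [X in _ + X]big1 ?addr0 => [|l ne_l].
          rewrite -scaler_suml; have := congr1 (fun A : 'M_n => A i i) (mulVmx uC).
          by rewrite !mxE eqxx => ->; rewrite scale1r.
        rewrite -scaler_suml; have := congr1 (fun A : 'M_n => A i l) (mulVmx uC).
        by rewrite !mxE eq_sym (negPf ne_l) => ->; rewrite scale0r.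
      rewrite scalerBr scaler_sumr; congr (_ - _); apply: eq_bigr => l _.
      by rewrite scalerA.
    apply: subspace_opp => //; have [_ _ SZ] := subS.
    apply: subspace_sum => // j _; apply: SZ.
    have := first_order_expansion (Phi j) ipt; rewrite -EPhi.
    have f0 : (tnth f j)@_0 = 0 by have [/invpP[]] := ihf j.
    rewrite -(mcoeff0_comp (Phi j) th0) -EPhi f0 mpolyC0 subr0.
    by congr (invp2H (_ - _)); apply: eq_bigr => l _; rewrite mxE.
  move=> /spant[a Sa]; rewrite -(subrK (\sum_i a i *: tnth th i) p).
  apply: sD; first exact: in_span_mod_base.
  by apply: (subspace_sum (subspace_in_span_mod subS (tnth f))) => i _; apply: sZ.
have homf i : tnth f i \is (e i).-homog for (wdeg d) by have [] := ihf i.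
have genH := generated_by_homog_span char0 d_gt0 rhoH_gr homf spanf.
apply/eqP; rewrite eqEsubset sHW /=; apply/subsetP=> w Ww.
(* A^H is now generated by W-invariants, so w fixes it and lies in [H]. *)
apply: (act_trivial_on_invariants sHW rho_faithful Ww) => p /genH[Q ->].
by apply: invariant_mPo Ww => i; have [/invpP[]] := ihf i.
Qed.

End ReflectionSubgroup.

(** * Generators of A as a module over A^W *)

Section ModuleGenerators.

Variables (k : fieldType) (n : nat) (gT : finGroupType) (W : {group gT}).
Variables (rho : mx_representation k W n) (d : 'I_n -> nat).
Hypotheses (char0 : [pchar k] =i pred0) (d_gt0 : forall i, (0 < d i)%N).
Hypothesis rho_gr : forall w, w \in W -> GLgrad d (rho w).
Hypothesis rho_faithful : mx_faithful rho.
Hypothesis rho_refl : <<[set w in W | is_reflection (rho w)]>>%g = W.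

Local Notation inv := (Defs.invariant rho W).
Local Notation invp := (invariant_plus d rho W).
Local Notation hc := (pihomog (wdeg d)).
Local Notation F := (invariant_ideal rho d).

(** Monomials independent modulo the Hilbert ideal are free over A^W, hence at most |W| in number; a
    maximal family of them generates A by induction on the degree. *)
Lemma module_generators : exists s (v : 'I_s -> {mpoly k[n]}), (s <= #|W|)%N /\
  forall p, exists2 q : 'I_s -> {mpoly k[n]}, forall j, inv (q j) & p = \sum_j q j * v j.
Proof.
have subF : subspace F by apply: subspace_ideal_mul.
have [|s [v [le_s Xv _ spanv]]] := maximal_free_mod subF (N := #|W|)
    (Q := fun q => exists m, q = 'X_[m]).
  move=> m v _ freev; apply: (invariant_free_le rho_faithful (z := v)) => g ig gv.
  apply: (free_over_invariants char0 d_gt0 rho_gr rho_refl (z := fun j (_ : 'I_1) => v j)) => //.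
  by move=> a Fa; apply: freev; apply: Fa ord0.
exists s, v; split=> //.
have {}spanv p : in_span_mod F v p.
  have [F0 FD FZ] := subspace_in_span_mod subF v.
  rewrite [p]mpolyE; apply: (subspace_sum (subspace_in_span_mod subF v)) => m _.
  by apply: FZ; apply: spanv; exists m.
pose gen p := exists2 q : 'I_s -> {mpoly k[n]}, forall j, inv (q j) & p = \sum_j q j * v j.
have [i0 iD iZ] := subspace_invariant rho W.
have gen0 : gen 0.
  by exists (fun=> 0) => //; rewrite big1 // => j _; rewrite mul0r.
have genD p1 p2 : gen p1 -> gen p2 -> gen (p1 + p2).
  move=> [q1 iq1 ->] [q2 iq2 ->]; exists (fun j => q1 j + q2 j) => [j|]; first exact: iD.
  by rewrite -big_split; apply: eq_bigr => j _; rewrite mulrDl.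
have genM t p : inv t -> gen p -> gen (t * p).
  move=> it [q iq ->]; exists (fun j => t * q j) => [j|]; first exact: invariantM.
  by rewrite mulr_sumr; apply: eq_bigr => j _; rewrite mulrA.
have subgen : subspace gen.
  by split=> // c p gp; rewrite -mul_mpolyC; apply: genM => //; apply: invariantC.
have genv j : gen (v j).
  exists (fun i => (i == j)%:R) => [i|].
    by case: (i == j) => //; rewrite -mpolyC1; apply: invariantC.
  by rewrite (bigD1 j) //= eqxx mul1r big1 ?addr0 // => i /negPf->; rewrite mul0r.
suff gen_hc N p : gen (hc N p).
  move=> p; have [N NP] := homog_components d p; rewrite (NP N) //.
  by apply: (subspace_sum subgen) => i _; apply: gen_hc.
elim/ltn_ind: N p => N IHN p; have [a Fa] := spanv (hc N p).
rewrite -(pihomog_id (wdeg d) N) -(subrK (\sum_i a i *: v i) (hc N p)) raddfD /=.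
apply: genD; last first.
  rewrite raddf_sum; apply: (subspace_sum subgen) => j _ /=.
  rewrite linearZ /= -mul_mpolyC; apply: genM; first exact: invariantC.
  have : hc N (v j) = v j \/ hc N (v j) = 0.
    by have [m ->] := Xv j; rewrite pihomogX; case: ifP; [left | right].
  by case=> ->.
move: (hc N p - _) Fa; apply: ideal_mul_elim => [|p1 p2|b t _ /(invariant_plusP char0 d_gt0 rho_gr)[it t0]].
- by rewrite raddf0.
- by have [_ gD _] := subgen; rewrite raddfD; apply: gD.
rewrite pihomogM; apply: (subspace_sum subgen) => -[i lt_iN] _ /=.
have [->|ne_iN] := eqVneq i N; first by rewrite subnn pihomog0_mcoeff // t0 mulr0.
rewrite mulrC; apply: genM; first exact: invariant_pihomog.
by apply: IHN; rewrite ltn_neqAle ne_iN -ltnS.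
Qed.

End ModuleGenerators.

(** * The tangent space of the quotient *)

Section TangentSpace.

Variables (k : fieldType) (n : nat) (d : 'I_n -> nat).
Hypotheses (char0 : [pchar k] =i pred0) (d_gt0 : forall i, (0 < d i)%N).
Variables (gT : finGroupType) (Wt : {group gT}) (rW : mx_representation k Wt n).
Hypothesis rW_graded : forall w, w \in Wt -> GLgrad d (rW w).
Hypothesis rW_faithful : mx_faithful rW.
Hypothesis rW_refl : <<[set w in Wt | is_reflection (rW w)]>>%g = Wt.
Variables (G : {group gT}) (nGW : (G <| Wt)%g).
Variables (r : nat) (e : 'I_r -> nat) (f : r.-tuple {mpoly k[n]}).
Hypothesis f_split : equivariant_splitting d rW G e f.
Variable rV : mx_representation k (Wt / G)%g r.
Hypothesis rV_tangent : tangent_action d rW f rV.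

Local Notation W := (Wt / G)%G.
Local Notation invG := (Defs.invariant rW G).
Local Notation invB := (Defs.invariant rW Wt).
Local Notation invpB := (invariant_plus d rW Wt).
Local Notation invp2B := (invariant_plus2 d rW Wt).
Local Notation invA := (Defs.invariant rV W).
Local Notation invpA := (invariant_plus e rV W).
Local Notation invp2A := (invariant_plus2 e rV W).
Local Notation I := (quotient_ideal f).
Local Notation hc := (pihomog (wdeg e)).

Let sGW : G \subset Wt. Proof. exact: normal_sub. Qed.

Let e_gt0 i : (0 < e i)%N.
Proof. by case: f_split => _ /(_ i)[]. Qed.

Let f_homog i : tnth f i \is (e i).-homog for (wdeg d).
Proof. by case: f_split => _ /(_ i)[]. Qed.

Let rWG_graded g : g \in G -> GLgrad d (rW g).
Proof. by move=> Gg; apply/rW_graded/(subsetP sGW). Qed.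

Let f_invp i : invariant_plus d rW G (tnth f i).
Proof. by case: f_split => -[]. Qed.

Let f_mcoeff0 i : (tnth f i)@_0 = 0.
Proof. by have /(invariant_plusP char0 d_gt0 rWG_graded)[] := f_invp i. Qed.

Lemma invariants_generated p : invG p -> generated_by f p.
Proof.
have [[_ spanf _] _ _] := f_split.
exact: (@generated_by_homog_span _ _ _ _ (subg_repr rW sGW) d char0 d_gt0 rWG_graded
  r f e f_homog spanf).
Qed.

Lemma normalizer_rW w : w \in Wt -> normalizer_GLgrad d rW G (rW w).
Proof.
move=> Ww; split=> [|M]; first exact: rW_graded.
have uw := repr_mx_unit rW Ww; have Nw := subsetP (normal_norm nGW) w Ww.
have WVw : (w^-1)%g \in Wt by rewrite groupV.
split=> -[g Gg EM]; have Wg := subsetP sGW g Gg.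
  exists (w * (g * w^-1))%g; last by rewrite !repr_mxM ?groupM // repr_mxV // mulmxA EM.
  by have := memJ_norm g (groupVr Nw); rewrite conjgE invgK => ->.
exists (w^-1 * (g * w))%g; first by rewrite -conjgE memJ_norm.
rewrite !repr_mxM ?groupM // repr_mxV // -EM.
by rewrite !mulmxA mulVmx // mul1mx mulmxKV.
Qed.

(** The equivariance of the splitting, applied to w in N(G), turns the congruence modulo (B^G_+)^2
    into an equality. *)
Lemma act_tangent w i : w \in Wt ->
  mpoly_act (rW w) (tnth f i) = \sum_j invmx (rV (coset G w)) i j *: tnth f j.
Proof.
move=> Ww; have [_ _ split] := f_split.
by apply: (split _ (normalizer_rW Ww) (invmx (rV (coset G w)))) => j; apply: rV_tangent.
Qed.

Lemma act_quotient w p : w \in Wt ->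
  mpoly_act (rV (coset G w)) p \mPo f = mpoly_act (rW w) (p \mPo f).
Proof.
move=> Ww; elim/(@mpoly_subring_ind k r): p => [c|i|p q IHp IHq|p q IHp IHq].
- by rewrite mpoly_actC comp_mpolyC mpoly_actC.
- rewrite comp_mpolyX1 act_tangent // mpoly_actX raddf_sum.
  by apply: eq_bigr => j _ /=; rewrite comp_mpolyZ comp_mpolyX1.
- by rewrite raddfD /= !comp_mpolyD IHp IHq raddfD.
by rewrite rmorphM /= !comp_mpolyM IHp IHq rmorphM.
Qed.

Lemma quotient_act x : x \in W -> exists2 w, w \in Wt &
  forall p, mpoly_act (rV x) p \mPo f = mpoly_act (rW w) (p \mPo f).
Proof. by case/morphimP=> w _ Ww ->; exists w => // p; apply: act_quotient. Qed.

(** The part of w . f_i outside degree e_i is zero, since w preserves degrees; independence of the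
    f_l kills the corresponding entries. *)
Lemma tangent_entry x i j : x \in W -> invmx (rV x) i j != 0 -> e i = e j.
Proof.
case/morphimP=> w _ Ww -> nz_ij; apply/eqP; apply: contraNT nz_ij => ne_ij.
have [[_ _ freef] _ _] := f_split.
pose a l := if e i == e l then 0 else invmx (rV (coset G w)) i l.
suff a0 : \sum_l a l *: tnth f l = 0.
  have /(_ j) : forall l, a l = 0 by apply: freef; rewrite a0; apply: ideal_mul0.
  by rewrite /a (negPf ne_ij) => ->.
have hom_w : pihomog (wdeg d) (e i) (mpoly_act (rW w) (tnth f i)) = mpoly_act (rW w) (tnth f i).
  by rewrite (pihomog_act _ _ char0 (rW_graded Ww)) (pihomog_homog _ (f_homog i)) eqxx.
pose T l := invmx (rV (coset G w)) i l.
transitivity (\sum_l T l *: tnth f l - \sum_l pihomog (wdeg d) (e i) (T l *: tnth f l)).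
  rewrite -sumrB; apply: eq_bigr => l _.
  rewrite linearZ /= (pihomog_homog _ (f_homog l)) /a.
  by case: eqP => _; rewrite ?scaler0 ?subr0 // scale0r subrr.
by rewrite -(linear_sum (pihomog (wdeg d) (e i))) -act_tangent //= hom_w subrr.
Qed.

Lemma rV_graded x : x \in W -> GLgrad e (rV x).
Proof.
move=> Wx; split=> [|t nz_t]; first exact: repr_mx_unit.
have WVx : (x^-1)%g \in W by rewrite groupV.
rewrite /grading_mx mul_diag_mx mul_mx_diag; apply/matrixP=> i j; rewrite !mxE.
have [-> | nz_ij] := eqVneq (rV x i j) 0; first by rewrite mul0r mulr0.
rewrite (@tangent_entry _ i j WVx) 1?mulrC //.
by rewrite repr_mxV // invmxK.
Qed.

Lemma pihomog_mPo_split p N : pihomog (wdeg d) N (p \mPo f) = hc N p \mPo f.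
Proof. exact: pihomog_comp. Qed.

Let mcoeff0_mPo_split p : (p \mPo f)@_0 = p@_0.
Proof. exact: mcoeff0_comp. Qed.

Let invpAP p : invpA p <-> invA p /\ p@_0 = 0.
Proof. by apply: invariant_plusP => // x Wx; apply: rV_graded. Qed.

Let invpBP p : invpB p <-> invB p /\ p@_0 = 0.
Proof. exact: invariant_plusP. Qed.

Lemma invariant_image p : invA p -> invB (p \mPo f).
Proof.
move=> ip w Ww; rewrite -act_quotient // ip //.
by apply: mem_morphim => //; apply: (subsetP (normal_norm nGW)).
Qed.

Lemma invariant_lift q : invB q -> exists2 p, invA p & q = p \mPo f.
Proof.
move=> iq; have [|p Ep] := @invariants_generated q.
  by move=> g Gg; apply: iq; apply: (subsetP sGW).
exists (reynolds rV W p); first exact: reynolds_inv.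
rewrite /reynolds comp_mpolyZ /transfer [X in _ = _ *: X]raddf_sum /=.
rewrite (eq_bigr (fun=> q)) => [|x Wx].
  by rewrite sumr_const -scaler_nat scalerA mulVf ?scale1r // card_neq0.
by have [w Ww ->] := quotient_act Wx; rewrite -Ep iq.
Qed.

Lemma invariant_plus_image p : invpA p -> invpB (p \mPo f).
Proof.
rewrite invpAP invpBP mcoeff0_mPo_split => -[ip p0].
by split=> //; apply: invariant_image.
Qed.

Lemma invariant_plus_lift q : invpB q -> exists2 p, invpA p & q = p \mPo f.
Proof.
move=> /invpBP[/invariant_lift[p ip ->]].
by rewrite mcoeff0_mPo_split => p0; exists p; rewrite ?invpAP.
Qed.

Lemma invariant_plus2_image p : invp2A p -> invp2B (p \mPo f).
Proof.
move: p; apply: ideal_mul_elim => [|p q|a b ia ib]; first by rewrite comp_mpoly0; apply: ideal_mul0.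
  by rewrite comp_mpolyD; apply: ideal_mulD.
by rewrite comp_mpolyM; apply: ideal_mul_prod; apply: invariant_plus_image.
Qed.

Lemma invariant_plus2_lift q : invp2B q -> exists2 p, invp2A p & q = p \mPo f.
Proof.
move: q; apply: ideal_mul_elim => [|_ _ [p ip ->] [q iq ->]|a b].
- by exists 0; [apply: ideal_mul0 | rewrite comp_mpoly0].
- by exists (p + q); [apply: ideal_mulD | rewrite comp_mpolyD].
move=> /invariant_plus_lift[p ip ->] /invariant_plus_lift[q iq ->].
by exists (p * q); [apply: ideal_mul_prod | rewrite comp_mpolyM].
Qed.

Lemma subspace_quotient_ideal : subspace I.
Proof.
split=> [|p q Ip Iq|c p Ip]; rewrite /quotient_ideal.
- by rewrite comp_mpoly0.
- by rewrite comp_mpolyD Ip Iq addr0.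
by rewrite comp_mpolyZ Ip scaler0.
Qed.

Lemma quotient_idealM a p : I p -> I (a * p).
Proof. by rewrite /quotient_ideal comp_mpolyM => ->; rewrite mulr0. Qed.

Lemma quotient_ideal_act x p : x \in W -> I p -> I (mpoly_act (rV x) p).
Proof.
move=> Wx Ip; rewrite /quotient_ideal; have [w Ww ->] := quotient_act Wx.
by rewrite Ip raddf0.
Qed.

Lemma quotient_ideal_pihomog p N : I p -> I (hc N p).
Proof. by rewrite /quotient_ideal -pihomog_mPo_split => ->; rewrite raddf0. Qed.

Lemma quotient_ideal_mcoeff0 p : I p -> p@_0 = 0.
Proof. by rewrite -mcoeff0_mPo_split => ->; rewrite mcoeff0. Qed.

Lemma quotient_ideal_reynolds p : I p -> I (reynolds rV W p).
Proof.
have [I0 ID IZ] := subspace_quotient_ideal.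
move=> Ip; apply: IZ; apply: (subspace_sum subspace_quotient_ideal) => x Wx.
exact: quotient_ideal_act.
Qed.

Definition invariant_quotient_ideal p : Prop := I p /\ invA p.

Local Notation IW := invariant_quotient_ideal.

Lemma invariant_quotient_ideal_invp p : IW p -> invpA p.
Proof. by move=> [Ip ip]; rewrite invpAP; split=> //; apply: quotient_ideal_mcoeff0. Qed.

Lemma invariant_quotient_ideal_pihomog p N : IW p -> IW (hc N p).
Proof.
move=> [Ip ip]; split; first exact: quotient_ideal_pihomog.
by apply: invariant_pihomog => // x Wx; apply: rV_graded.
Qed.

Lemma irrelevant_mul_idealE p :
  irrelevant_mul_ideal e f p <-> ideal_mul (fun a : {mpoly k[r]} => a@_0 = 0) I p.
Proof.
by split; apply: ideal_mul_mono => // a; rewrite irrelevantP // => -[].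
Qed.

Lemma basic_invariants_lift : exists (ps : n.-tuple {mpoly k[n]})
    (pt : n.-tuple {mpoly k[r]}) (e' : 'I_n -> nat),
  [/\ forall i, invpA (tnth pt i) /\ tnth pt i \is (e' i).-homog for (wdeg e),
      forall i, tnth ps i = tnth pt i \mPo f,
      free_mod invp2B (tnth ps),
      forall p, invpB p -> in_span_mod invp2B (tnth ps) p
    & forall p, invB p -> generated_by ps p].
Proof.
have [s [ps [e' [le_sn ips freeps spanps genps]]]] :=
  basic_invariants_exist char0 d_gt0 rW_graded rW_faithful rW_refl.
have eq_sn : s = n.
  by apply/eqP; rewrite eqn_leq le_sn (generators_ge char0 rW_faithful genps).
subst s.
have /fin_all_exists[pt ptP] i : exists p, [/\ invpA p, p \is (e' i).-homog for (wdeg e)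
    & tnth ps i = p \mPo f].
  have [/invariant_plus_lift[p ip Ep] hi] := ips i.
  exists (hc (e' i) p); split; [| exact: pihomogP |].
    by apply: invariant_plus_pihomog => // x Wx; apply: rV_graded.
  by rewrite -pihomog_mPo_split -Ep pihomog_dE.
exists ps, [tuple pt i | i < n], e'; split=> // i; rewrite tnth_mktuple;
  by have [] := ptP i.
Qed.

Definition join m (a : 'I_m -> {mpoly k[r]}) l (b : 'I_l -> {mpoly k[r]}) :
    (m + l).-tuple {mpoly k[r]} :=
  [tuple match split i with inl j => a j | inr j => b j end | i < m + l].

Lemma join_lshift m a l b j : tnth (@join m a l b) (lshift l j) = a j.
Proof. by rewrite tnth_mktuple (unsplitK (inl j)). Qed.

Lemma join_rshift m a l b j : tnth (@join m a l b) (rshift m j) = b j.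
Proof. by rewrite tnth_mktuple (unsplitK (inr j)). Qed.

Lemma join_ind m a l b (P : {mpoly k[r]} -> Prop) :
  (forall j, P (a j)) -> (forall j, P (b j)) -> forall i, P (tnth (@join m a l b) i).
Proof. by move=> Pa Pb i; rewrite tnth_mktuple; case: splitP. Qed.

Lemma join_sum m a l b (c : 'I_(m + l) -> k) :
  \sum_i c i *: tnth (@join m a l b) i
    = \sum_j c (lshift l j) *: a j + \sum_j c (rshift m j) *: b j.
Proof.
by rewrite big_split_ord; congr (_ + _); apply: eq_bigr => j _;
  rewrite ?join_lshift ?join_rshift.
Qed.

Let subS : subspace invp2A.
Proof. by apply: subspace_invariant_plus2 => // x Wx; apply: rV_graded. Qed.

(** * Generators of A^W adapted to I *)

Section AdaptedGenerators.

Variables (ps : n.-tuple {mpoly k[n]}) (pt : n.-tuple {mpoly k[r]}) (e' : 'I_n -> nat).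
Hypothesis pt_invp : forall i, invpA (tnth pt i) /\ tnth pt i \is (e' i).-homog for (wdeg e).
Hypothesis pt_lift : forall i, tnth ps i = tnth pt i \mPo f.
Hypothesis ps_free : free_mod invp2B (tnth ps).
Hypothesis ps_span : forall p, invpB p -> in_span_mod invp2B (tnth ps) p.
Hypothesis ps_gen : forall p, invB p -> generated_by ps p.
Variables (m : nat) (a : 'I_m -> {mpoly k[r]}).
Hypothesis a_IW : forall j, IW (a j) /\ exists N, a j \is N.-homog for (wdeg e).

Local Notation F := (join a (tnth pt)).

Let pt_sum_image (c : 'I_n -> k) :
  (\sum_i c i *: tnth pt i) \mPo f = \sum_i c i *: tnth ps i.
Proof.
rewrite raddf_sum; apply: eq_bigr => i _ /=.
by rewrite comp_mpolyZ pt_lift.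
Qed.

(** Restriction to B kills the a_j and sends the lifts to the psi_i, whose independence removes
    their coefficients. *)
Lemma adapted_free : free_mod invp2A a -> free_mod invp2A (tnth F).
Proof.
have [I0 ID IZ] := subspace_quotient_ideal.
move=> freea c; rewrite join_sum => Sc.
have cr0 j : c (rshift m j) = 0.
  apply: (ps_free (a := fun j => c (rshift m j))).
  have := invariant_plus2_image Sc; rewrite comp_mpolyD pt_sum_image.
  rewrite (_ : (\sum_j _) \mPo f = 0) ?add0r //.
  by apply: (subspace_sum subspace_quotient_ideal) => l _; apply: IZ; have [[]] := a_IW l.
move=> i; rewrite -(splitK i); case: (split i) => [j|j]; last exact: cr0.
apply: (freea (fun j => c (lshift n j))); move: Sc.
by rewrite [X in _ + X]big1 ?addr0 // => l _; rewrite cr0 scale0r.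
Qed.

Lemma adapted_generators : (forall q, IW q -> in_span_mod invp2A a q) ->
  exists eF : 'I_(m + n) -> nat,
    (forall i, invpA (tnth F i) /\ tnth F i \is (eF i).-homog for (wdeg e)) /\
    (forall p, invA p -> generated_by F p).
Proof.
move=> spana.
have [invF /fin_all_exists[eF homF]] : (forall i, invpA (tnth F i)) /\
    (forall i, exists N, tnth F i \is N.-homog for (wdeg e)).
  split; [apply: (join_ind (P := invpA)) => j
         |apply: (join_ind (P := fun q => exists N, q \is N.-homog for (wdeg e))) => j].
  - by apply: invariant_quotient_ideal_invp; have [] := a_IW j.
  - by have [] := pt_invp j.
  - by have [] := a_IW j.
  by exists (e' j); have [] := pt_invp j.
exists eF; split=> //.
apply: (generated_by_homog_span char0 e_gt0 rV_graded homF) => p ip.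
have [a1 Sq] := ps_span (invariant_plus_image ip).
have [s Ss Es] := invariant_plus2_lift Sq.
have [_ _ pZ] : subspace invpA.
  by apply: subspace_invariant_plus => // x Wx; apply: rV_graded.
have subp : subspace invpA.
  by apply: subspace_invariant_plus => // x Wx; apply: rV_graded.
(* Subtracting from p a combination of the lifts, and a lift in (A^W_+)^2 of the remainder of its
   image, leaves an element of I^W. *)
have /spana[a2 Sa2] : IW (p - \sum_i a1 i *: tnth pt i - s).
  split; first by rewrite /quotient_ideal !comp_mpolyB pt_sum_image Es subrr.
  have [] // : invpA (p - \sum_i a1 i *: tnth pt i - s) /\ True.
    split=> //; apply: subspace_sub => //; first apply: subspace_sub => //.
      by apply: (subspace_sum subp) => i _; apply: pZ; have [] := pt_invp i.
    apply: invariant_plus2_plus Ss => // x Wx; exact: rV_graded.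
  by move=> /invpAP[].
exists (fun i => match split i with inl j => a2 j | inr j => a1 j end).
rewrite join_sum.
rewrite (eq_bigr (fun j => a2 j *: a j)) => [|j _]; last by rewrite (unsplitK (inl j)).
rewrite [X in _ - (_ + X)](eq_bigr (fun j => a1 j *: tnth pt j)) => [|j _]; last first.
  by rewrite (unsplitK (inr j)).
have [_ SD _] := subS; have := SD _ _ Sa2 Ss; congr invp2A.
by move: (\sum_j _) (\sum_j _) => ? ?; ring.
Qed.

Lemma adapted_elimination p : generated_by F p ->
  exists (R : {mpoly k[n]}) (h : 'I_m -> {mpoly k[r]}),
    p = \sum_j h j * a j + (R \mPo pt).
Proof.
case=> P ->.
elim/(@mpoly_subring_ind k (m + n)): P => [c|i|p1 p2 [R1 [h1 E1]] [R2 [h2 E2]]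
                                          |p1 p2 [R1 [h1 E1]] [R2 [h2 E2]]].
- exists c%:MP, (fun=> 0); rewrite !comp_mpolyC big1 ?add0r // => j _.
  by rewrite mul0r.
- rewrite comp_mpolyX1; rewrite tnth_mktuple; case: splitP => j _.
    exists 0, (fun l => (l == j)%:R); rewrite comp_mpoly0 addr0 (bigD1 j) //= eqxx mul1r.
    by rewrite big1 ?addr0 // => l /negPf->; rewrite mul0r.
  exists 'X_j, (fun=> 0); rewrite comp_mpolyX1 big1 ?add0r // => l _.
  by rewrite mul0r.
- exists (R1 + R2), (fun j => h1 j + h2 j); rewrite !comp_mpolyD E1 E2.
  rewrite addrACA -big_split; congr (_ + _); apply: eq_bigr => j _.
  by rewrite mulrDl.
exists (R1 * R2), (fun j => h1 j * (p2 \mPo F) + (R1 \mPo pt) * h2 j).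
rewrite !comp_mpolyM {1}E1 mulrDl {2}E2 mulrDr addrA mulr_suml mulr_sumr -big_split.
by congr (_ + _); apply: eq_bigr => j _; rewrite /= mulrDl mulrAC -!mulrA.
Qed.

(** Modulo (a_j), p is a polynomial R in the lifts; its restriction gives R(psi) = 0, and R = 0 by
    the Jacobian criterion. *)
Lemma adapted_ideal p : (forall q, invA q -> generated_by F q) ->
  IW p -> exists h : 'I_m -> {mpoly k[r]}, p = \sum_j h j * a j.
Proof.
move=> genF [Ip ip]; have [R [h Ep]] := adapted_elimination (genF p ip).
suff R0 : R = 0 by exists h; rewrite Ep R0 comp_mpoly0 addr0.
apply: (jacobian_algebraic_independence char0 (generators_jacobian_neq0 char0 rW_faithful ps_gen)).
have -> : R \mPo ps = (R \mPo pt) \mPo f.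
  rewrite comp_mpolyA; congr (R \mPo _); apply: eq_from_tnth => i.
  by rewrite tnth_mktuple pt_lift.
move: Ip; rewrite /quotient_ideal Ep comp_mpolyD raddf_sum big1 ?add0r // => j _ /=.
by rewrite comp_mpolyM; have [[-> _] _] := a_IW j; rewrite mulr0.
Qed.

End AdaptedGenerators.

(** * Passage from I^W to I, and the two implications *)

Lemma quotient_rank_free (b : coset_of G -> {mpoly k[n]}) :
  (forall p, \sum_(x in W) b x * (mpoly_act (rV x) p \mPo f) = 0) ->
  forall x, x \in W -> b x = 0.
Proof.
move=> b0 x /morphimP[w0 Nw0 Ww0 ->{x}].
(* Independence of the maps B^G -> B given by W reduces to that of Wt on B: it is tested on
   transfers over G, and the sum over Wt is grouped by cosets. *)
apply: (act_independence rW_faithful (c := fun w => b (coset G w))) Ww0 => y.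
have iT : invG (transfer rW G y) by apply: transfer_inv.
have [P EP] := invariants_generated iT.
rewrite -[RHS](b0 P) (partition_big (coset G) (mem W)) => [|w Ww]; last first.
  by apply: mem_morphim => //; apply: (subsetP (normal_norm nGW)).
apply: eq_bigr => x /morphimP[w Nw Ww ->{x}].
rewrite act_quotient // -EP raddf_sum /= mulr_sumr.
have in_coset g : ((w * g)%g \in Wt) && (coset G (w * g)%g == coset G w) = (g \in G).
  rewrite (groupMl _ Ww); have [Wg /= | nWg] := boolP (g \in Wt); last first.
    by apply/esym/negbTE; apply: contra nWg; apply: (subsetP sGW).
  have Ng := subsetP (normal_norm nGW) g Wg.
  rewrite (sameP eqP (rcoset_kercosetP (groupM Nw Ng) Nw)) mem_rcoset.
  by rewrite -(memJ_norm g (groupVr Nw)) conjgE invgK mulgA.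
rewrite [LHS](reindex_inj (mulgI w)); apply: eq_big => [g|g]; first exact: in_coset.
move=> Pg; have Gg : g \in G by rewrite -in_coset.
have /andP[_ /eqP->] := Pg.
by rewrite (actMg _ _ Ww (subsetP sGW g Gg)).
Qed.

(** The images in B of the W-conjugates of the v_j form a matrix with independent rows, so s = |W|
    and its determinant is nonzero. As all conjugates of p map to 0, so do the coefficients q_j. *)
Lemma module_syzygies s (v : 'I_s -> {mpoly k[r]}) : (s <= #|W|)%N ->
    (forall p, exists2 q : 'I_s -> {mpoly k[r]}, forall j, invA (q j) & p = \sum_j q j * v j) ->
  forall p, I p -> exists2 q : 'I_s -> {mpoly k[r]}, forall j, IW (q j) & p = \sum_j q j * v j.
Proof.
move=> le_s genv; have W1 : 1%g \in W by apply: group1.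
pose M : 'M[{mpoly k[n]}]_(#|W|, s) :=
  \matrix_(i, j) (mpoly_act (rV (enum_val i)) (v j) \mPo f).
have freeM (b : 'rV_#|W|) : b *m M = 0 -> b = 0.
  move=> bM; have b0 x : x \in W -> b 0 (enum_rank_in W1 x) = 0.
    apply: (quotient_rank_free (b := fun x => b 0 (enum_rank_in W1 x))) => p.
    have [q iq ->] := genv p.
    rewrite (eq_bigr (fun x => \sum_j (q j \mPo f) *
        (b 0 (enum_rank_in W1 x) * (mpoly_act (rV x) (v j) \mPo f)))) => [|y Wy].
      rewrite exchange_big big1 // => j _ /=; rewrite -mulr_sumr.
      rewrite big_enum_val /=; have := congr1 (fun A : 'rV_s => A 0 j) bM.
      rewrite !mxE => bM0; rewrite [X in _ * X](_ : _ = 0) ?mulr0 //.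
      rewrite -[RHS]bM0; apply: eq_bigr => i _.
      by rewrite mxE enum_valK_in.
    rewrite (linear_sum (mpoly_act (rV y))) (linear_sum (comp_mpoly f)) mulr_sumr; apply: eq_bigr => j _ /=.
    by rewrite rmorphM /= iq // comp_mpolyM mulrCA.
  apply/rowP=> i; rewrite mxE -[i](enum_valK_in W1); apply: b0.
  exact: enum_valP.
have le_Ws : (#|W| <= s)%N.
  rewrite leqNgt; apply/negP=> /(wide_kernel M)[b /eqP nz_b /freeM]; exact: nz_b.
have eq_s : s = #|W| by apply/eqP; rewrite eqn_leq le_s.
clear le_s le_Ws; subst s; have detM : \det M != 0.
  by apply/negP=> /det0P[b /eqP nz_b /freeM]; apply: nz_b.
move=> p Ip; have [q iq Ep] := genv p; exists q => // j; split=> //.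
pose c : 'rV_#|W| := \row_j (q j \mPo f).
suff /rowP/(_ j) : c = 0 by rewrite !mxE.
apply: (det_mulmx_inj (J := M^T)); first by rewrite det_tr.
apply/rowP=> i; rewrite !mxE.
have Wi : enum_val i \in W by apply: enum_valP.
have := quotient_ideal_act Wi Ip; rewrite /quotient_ideal Ep (linear_sum (mpoly_act _)) (linear_sum (comp_mpoly f)) => p0.
rewrite -[RHS]p0; apply: eq_bigr => l _; rewrite !mxE /=.
by rewrite rmorphM /= iq // comp_mpolyM.
Qed.

(** Averaging sends A_+ a_j into A^W_+ a_j. This transfers congruences modulo A_+ I to congruences
    modulo (A^W_+)^2. *)
Lemma irrelevant_mul_ideal_reynolds m (a : 'I_m -> {mpoly k[r]}) u :
    (forall j, invpA (a j)) ->
    (forall p, I p -> exists h : 'I_m -> {mpoly k[r]}, p = \sum_j h j * a j) ->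
  irrelevant_mul_ideal e f u -> invp2A (reynolds rV W u).
Proof.
move=> ia gena /irrelevant_mul_idealE Uu.
apply: (reynolds_mul_invariant char0 (subxx W) e_gt0 rV_graded).
move: u Uu; apply: ideal_mul_elim => [|p q|b p b0 /gena[h ->]].
- exact: ideal_mul0.
- exact: ideal_mulD.
rewrite mulr_sumr; apply: big_ind => [||j _]; [exact: ideal_mul0 | exact: ideal_mulD |].
by rewrite mulrA; apply: ideal_mul_prod => //; rewrite mcoeff0M b0 mul0r.
Qed.

Lemma reflection_quotient_necessary :
    mx_faithful rV -> <<[set w in W | is_reflection (rV w)]>>%g = W ->
  complete_intersection f /\
  forall w, w \in (Wt / G)%g -> forall p : {mpoly k[r]},
    quotient_ideal f p -> irrelevant_mul_ideal e f (mpoly_act (rV w) p - p).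
Proof.
move=> rV_faithful rV_refl.
have [ps [pt [e' [pt_invp pt_lift ps_free ps_span ps_gen]]]] := basic_invariants_lift.
have [|m [a [_ aQ freea spana]]] := maximal_free_mod subS (N := r)
    (Q := fun q => IW q /\ exists N, q \is N.-homog for (wdeg e)).
  move=> m v vQ freev.
  apply: (free_invariants_le char0 e_gt0 rV_graded rV_faithful rV_refl) freev => j.
  by apply: invariant_quotient_ideal_invp; have [] := vQ j.
have {}spana q : IW q -> in_span_mod invp2A a q.
  move=> IWq; have [N NP] := homog_components e q; rewrite (NP N) //.
  apply: (subspace_sum (subspace_in_span_mod subS a)) => i _; apply: spana.
  by split; [apply: invariant_quotient_ideal_pihomog | exists i; apply: pihomogP].
have freeF := adapted_free pt_lift ps_free aQ freea.
have [eF [FP genF]] := adapted_generators pt_invp pt_lift ps_span aQ spana.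
(* The joined family is independent modulo (A^W_+)^2 and generates A^W: its size is at most and at
   least r. *)
have eq_r : (m + n = r)%N.
  apply/eqP; rewrite eqn_leq (generators_ge char0 rV_faithful genF) andbT.
  apply: (free_invariants_le char0 e_gt0 rV_graded rV_faithful rV_refl) freeF => i.
  by have [] := FP i.
have aI j : I (a j) by have [[]] := aQ j.
have ia j : invpA (a j) by apply: invariant_quotient_ideal_invp; have [] := aQ j.
have genI p : I p -> exists h : 'I_m -> {mpoly k[r]}, p = \sum_j h j * a j.
  have [s [v [le_s genv]]] := module_generators char0 e_gt0 rV_graded rV_faithful rV_refl.
  move=> /(module_syzygies le_s genv)[q IWq ->].
  have /fin_all_exists[h Eh] j := adapted_ideal pt_lift ps_gen aQ genF (IWq j).
  exists (fun i => \sum_j h j i * v j).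
  rewrite (eq_bigr (fun j => \sum_i h j i * v j * a i)) => [|j _].
    by rewrite exchange_big; apply: eq_bigr => i _; rewrite mulr_suml.
  by rewrite {1}Eh mulr_suml; apply: eq_bigr => i _; rewrite mulrAC.
have [I0 ID IZ] := subspace_quotient_ideal.
split.
  exists m; last by rewrite addnC.
  split.
    exists [tuple a j | j < m] => p; split.
      move=> /genI[h Eh]; exists h; rewrite Eh.
      by apply: eq_bigr => j _; rewrite tnth_mktuple.
    move=> [c ->]; apply: (subspace_sum subspace_quotient_ideal) => j _.
    by rewrite tnth_mktuple; apply: quotient_idealM.
  (* Minimality: the a_j are independent modulo A_+ I, while any generators of I span I / A_+ I. *)
  move=> m' s gens.
  have subU : subspace (irrelevant_mul_ideal e f).
    by apply: subspace_ideal_mul; split=> [|p q Pp Pq|c p Pp];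
       rewrite irrelevantP // ?mcoeff0 //; move: Pp; rewrite irrelevantP // => -[_ p0];
       [move: Pq; rewrite irrelevantP // => -[_ q0]; rewrite mcoeffD p0 q0 addr0
       |rewrite mcoeffZ p0 mulr0].
  apply: (free_mod_le subU (v := a) (w := tnth s)) => [c Uc | j].
    apply: freea; have := irrelevant_mul_ideal_reynolds ia genI Uc.
    rewrite reynolds_id //.
    have [_ _ iZ] := subspace_invariant rV W.
    apply: (subspace_sum (subspace_invariant rV W)) => j _; apply: iZ.
    by have /invpAP[] := ia j.
  have /gens[c Ec] := aI j; exists (fun i => (c i)@_0).
  have Is i : I (tnth s i).
    apply/gens; exists (fun l => (l == i)%:R); rewrite (bigD1 i) //= eqxx mul1r.
    by rewrite big1 ?addr0 // => l /negPf->; rewrite mul0r.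
  rewrite Ec -sumrB; apply: (subspace_sum subU) => i _; apply/irrelevant_mul_idealE.
  rewrite -mul_mpolyC -mulrBl; apply: ideal_mul_prod => //.
  by rewrite mcoeffB mcoeffC eqxx mulr1 subrr.
(* For each term, w (h a_j) - h a_j = (w h - h) a_j, and w h - h vanishes at 0. *)
move=> w Ww p /genI[h ->]; apply/irrelevant_mul_idealE.
rewrite raddf_sum -sumrB; apply: big_ind => [||j _]; [exact: ideal_mul0 | exact: ideal_mulD |].
have /invpAP[ivj _] := ia j; rewrite /= rmorphM /= ivj // -mulrBl.
by apply: ideal_mul_prod => //; rewrite mcoeffB mpoly_act_mcoeff0 subrr.
Qed.

Lemma reflection_quotient_sufficient :
    complete_intersection f ->
    (forall w, w \in (Wt / G)%g -> forall p : {mpoly k[r]},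
       quotient_ideal f p -> irrelevant_mul_ideal e f (mpoly_act (rV w) p - p)) ->
  mx_faithful rV /\ <<[set w in W | is_reflection (rV w)]>>%g = W.
Proof.
move=> [m [[s gens] _] eq_r] triv.
(* An element of Wt acting trivially on V fixes B^G, which the f_i generate, hence lies in G. *)
have rV_faithful : mx_faithful rV.
  apply/subsetP=> x /rkerP[/morphimP[w Nw Ww ->{x}] rw1]; rewrite inE.
  apply/eqP/coset_id; apply: (act_trivial_on_invariants sGW rW_faithful Ww) => p ip.
  have [P ->] := invariants_generated ip.
  by rewrite -act_quotient // rw1 mpoly_act1.
split=> //.
have [I0 ID IZ] := subspace_quotient_ideal.
have subp0 : subspace (fun p : {mpoly k[r]} => p@_0 = 0).
  split=> [|p q p0 q0|c p p0]; first exact: mcoeff0.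
    by rewrite mcoeffD p0 q0 addr0.
  by rewrite mcoeffZ p0 mulr0.
pose U := ideal_mul (fun a : {mpoly k[r]} => a@_0 = 0) I.
have subU : subspace U by apply: subspace_ideal_mul.
have [U0 UD UZ] := subU.
have Is i : I (tnth s i).
  apply/gens; exists (fun l => (l == i)%:R); rewrite (bigD1 i) //= eqxx mul1r.
  by rewrite big1 ?addr0 // => l /negPf->; rewrite mul0r.
have spans p : I p -> in_span_mod U (tnth s) p.
  move=> /gens[c Ec]; exists (fun i => (c i)@_0).
  rewrite Ec -sumrB; apply: (subspace_sum subU) => i _.
  rewrite -mul_mpolyC -mulrBl; apply: ideal_mul_prod => //.
  by rewrite mcoeffB mcoeffC eqxx mulr1 subrr.
(* The m given generators span I / A_+ I and so bound m'; they may be neither homogeneous nor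
   invariant, unlike the a_j. *)
have [|m' [a [le_m aQ _ spana]]] := maximal_free_mod subU (N := m)
    (Q := fun q => IW q /\ exists N, q \is N.-homog for (wdeg e)).
  move=> l v vQ freev; apply: (free_mod_le subU freev (w := tnth s)) => j.
  by apply: spans; have [[]] := vQ j.
have aI j : I (a j) by have [[]] := aQ j.
have ia j : invpA (a j) by apply: invariant_quotient_ideal_invp; have [] := aQ j.
(* By triviality of the action on I / A_+ I, p is congruent to its average, whose components lie in
   I^W. *)
have {}spana p : I p -> in_span_mod U a p.
  have subsp := subspace_in_span_mod subU a; have [_ sD _] := subsp.
  move=> Ip; rewrite -(subKr (reynolds rV W p) p); apply: (subspace_sub subsp).
    have [N NP] := homog_components e (reynolds rV W p); rewrite (NP N) //.
    apply: (subspace_sum subsp) => i _; apply: spana; split.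
      apply: invariant_quotient_ideal_pihomog; split; first exact: quotient_ideal_reynolds.
      exact: reynolds_inv.
    by exists i; apply: pihomogP.
  apply: in_span_mod_base => //.
  rewrite -[X in _ - X]scale1r -(mulVf (card_neq0 W char0)) -scalerA -scalerBr.
  apply: UZ; rewrite scaler_nat -sumr_const -sumrB; apply: (subspace_sum subU) => x Wx.
  by apply/irrelevant_mul_idealE; apply: triv.
pose J p := exists h : 'I_m' -> {mpoly k[r]}, p = \sum_j h j * a j.
have subJ : subspace J.
  split=> [|p q [h ->] [h' ->]|c p [h ->]].
  - by exists (fun=> 0); rewrite big1 // => j _; rewrite mul0r.
  - exists (fun j => h j + h' j); rewrite -big_split; apply: eq_bigr => j _.
    by rewrite mulrDl.
  exists (fun j => c *: h j); rewrite scaler_sumr; apply: eq_bigr => j _.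
  by rewrite scalerAl.
have [J0 JD JZ] := subJ.
have JM b p : J p -> J (b * p).
  move=> [h ->]; exists (fun j => b * h j); rewrite mulr_sumr; apply: eq_bigr => j _.
  by rewrite mulrA.
have Ja j : J (a j).
  exists (fun l => (l == j)%:R); rewrite (bigD1 j) //= eqxx mul1r.
  by rewrite big1 ?addr0 // => l /negPf->; rewrite mul0r.
have genI p : I p -> J p.
  suff gen N q : I q -> J (hc N q).
    move=> Ip; have [N NP] := homog_components e p; rewrite (NP N) //.
    by apply: (subspace_sum subJ) => i _; apply: gen.
  (* Graded Nakayama for I: in A_+ I, the factor from I has smaller degree. *)
  elim/ltn_ind: N q => N IHN q Iq.
  have [c Uc] := spana _ (quotient_ideal_pihomog N Iq).
  rewrite -(pihomog_id (wdeg e) N) -(subrK (\sum_i c i *: a i) (hc N q)) raddfD /=.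
  apply: (JD); last first.
    rewrite raddf_sum; apply: (subspace_sum subJ) => j _ /=.
    rewrite linearZ /=; apply: (JZ); have [_ [M hM]] := aQ j.
    by rewrite (pihomog_homog _ hM); case: ifP.
  move: (hc N q - _) Uc; apply: ideal_mul_elim => [|p1 p2|b t b0 It].
  - by rewrite raddf0.
  - by rewrite raddfD; apply: (JD).
  rewrite pihomogM; apply: (subspace_sum subJ) => -[i lt_iN] _ /=.
  have [->|i_gt0] := posnP i; first by rewrite pihomog0_mcoeff // b0 mul0r.
  have [->|ne_iN] := eqVneq i N.
    by rewrite subnn (pihomog0_mcoeff t) // quotient_ideal_mcoeff0 // mulr0.
  apply: (JM); apply: IHN => //; rewrite ltn_subrL i_gt0 /=.
  by apply: leq_trans i_gt0 _; rewrite -ltnS.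
have [ps [pt [e' [pt_invp pt_lift ps_free ps_span ps_gen]]]] := basic_invariants_lift.
have spanS q : IW q -> in_span_mod invp2A a q.
  move=> [Iq iq]; have [c Uc] := spana q Iq; exists c.
  have := irrelevant_mul_ideal_reynolds ia genI (iffRL (irrelevant_mul_idealE _) Uc).
  rewrite reynolds_id //; apply: (subspace_sub (subspace_invariant rV W)) => //.
  have [_ _ iZ] := subspace_invariant rV W.
  apply: (subspace_sum (subspace_invariant rV W)) => j _; apply: iZ.
  by have /invpAP[] := ia j.
have [eF [FP genF]] := adapted_generators pt_invp pt_lift ps_span aQ spanS.
apply: (serre_reflection_group char0 e_gt0 rV_graded rV_faithful _ FP genF).
by rewrite -eq_r addnC leq_add2l.
Qed.

End TangentSpace.

Theorem mainTheorem1 (k : fieldType) (char0 : [pchar k] =i pred0)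
    (* the graded space Vt and the reflection group Wt in GL_grad(Vt) *)
    (n : nat) (d : 'I_n -> nat) (d_gt0 : forall i, (0 < d i)%N)
    (gT : finGroupType) (Wt : {group gT}) (rW : mx_representation k Wt n)
    (rW_graded : forall w, w \in Wt -> GLgrad d (rW w))
    (rW_refl : reflection_group rW)
    (G : {group gT}) (nGW : (G <| Wt)%g)
    (* the tangent space V at 0 to Vt / G, the splitting V^* -> B^G_+, and the
       action of W = Wt / G on V *)
    (r : nat) (e : 'I_r -> nat) (f : r.-tuple {mpoly k[n]})
    (f_split : equivariant_splitting d rW G e f)
    (rV : mx_representation k (Wt / G)%g r)
    (rV_tangent : tangent_action d rW f rV) :
  reflection_group rV <->
  (complete_intersection f /\
   forall w, w \in (Wt / G)%g -> forall p : {mpoly k[r]},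
     quotient_ideal f p ->
     irrelevant_mul_ideal e f (mpoly_act (rV w) p - p)).
Proof.
have [rW_faithful rW_gen] := rW_refl.
split=> [[rV_faithful rV_gen] | [ci triv]].
  exact: (reflection_quotient_necessary char0 d_gt0 rW_graded rW_faithful rW_gen
    nGW f_split rV_tangent rV_faithful rV_gen).
exact: (reflection_quotient_sufficient char0 d_gt0 rW_graded rW_faithful rW_gen
  nGW f_split rV_tangent ci triv).
Qed.
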